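(* Every group is isomorphic to the fundamental group of a wedge product of circles and link-connected $2$-complexes.
   Context: A polygon is a closed $2$-disc whose boundary circle has been given the structure of a graph; it is an $n$-gon if the boundary cycle has $n\ge 1$ edges. A (combinatorial) $2$-complex $X$ is obtained from a graph $\Gamma$ and a collection $\mathcal{P}$ of disjoint polygons by attaching the boundary cycle of each $n$-gon along a closed combinatorial path of length $n$ in $\Gamma$. Loops and multiple edges are allowed in $\Gamma$. Let $P$ be the disjoint union of the polygons. If $X$ has no isolated vertices and every edge of $\Gamma$ lies in the image of at least one attaching map, then $X$ is a quotient of $P$ by a map $f:P\twoheadrightarrow X$ sending each open cell homeomorphically onto an open cell; in this case $X$ is called a polygon quotient. For a vertex $u$ of a polygon quotient $X$, the graph $\mathrm{Link}(u,X)$ is defined as follows. Take one closed edge for each vertex $v$ of $P$ with $f(v)=u$, and associate its two endpoints with the two ends of edges of $P$ that are attached at $v$. Then identify endpoints of these closed edges if and only if the corresponding ends of edges in $P$ are identified by $f$. A link-connected $2$-complex is a polygon quotient $X$ such that $\mathrm{Link}(u,X)$ is connected for every vertex $u$ of $X$. The wedge product is taken over an arbitrary (possibly empty, possibly infinite) family of spaces, each of which is either a circle or a (path-connected) link-connected $2$-complex; the spaces are joined at a chosen base vertex of each. *)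

(* Defs.v *)
From HB Require Import structures.
From Stdlib Require Import Relation_Operators.
From mathcomp Require Import all_boot all_order all_algebra generic_quotient.
From mathcomp Require Import all_classical all_reals all_analysis.
From mathcomp Require Import homotopy lra.
Import Order.TTheory GRing.Theory Num.Theory.
Import numFieldNormedType.Exports.

Set Implicit Arguments.
Unset Strict Implicit.
Unset Printing Implicit Defensive.

Local Open Scope classical_set_scope.
Local Open Scope ring_scope.
Local Open Scope quotient_scope.

Section unit_interval.
Variable R : realType.

Definition unit_interval : Type := set_type `[0 : R, 1]%classic.

HB.instance Definition _ :=
  Topological.copy unit_interval (set_type `[0 : R, 1]%classic).

Fact clampI_subproof (r : R) : Num.max 0 (Num.min 1 r) \in `[0, 1]%classic.
Proof.
apply/mem_set; rewrite /= in_itv /= le_max lexx /= ge_max ler01 /=.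
by rewrite ge_min lexx.
Qed.

(* The retraction of the real line onto [0, 1]; it serves to turn real numbers
   already known to lie in [0, 1] into points of unit_interval. *)
Definition clampI (r : R) : unit_interval :=
  exist (fun x : R => x \in `[0, 1]%classic) _ (clampI_subproof r).

Lemma clampIE (r : R) : 0 <= r <= 1 -> sval (clampI r) = r.
Proof. by case/andP => r0 r1; rewrite /= (min_r r1) (max_r r0). Qed.

Arguments clampI : simpl never.

Lemma clampIK (t : unit_interval) : clampI (sval t) = t.
Proof.
apply: val_inj; case: t => t /= /set_mem /=; rewrite in_itv /= => t01.
exact: (clampIE t01).
Qed.

Lemma unit_intervalP (t : unit_interval) : 0 <= sval t <= 1.
Proof. by case: t => t /= /set_mem /=; rewrite in_itv. Qed.

Fact unit_interval_neq : clampI 0 != clampI 1.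
Proof.
apply/eqP => /(congr1 sval); rewrite !clampIE ?lexx ?ler01 // => /eqP.
by rewrite eq_sym oner_eq0.
Qed.

HB.instance Definition _ := isBiPointed.Build unit_interval unit_interval_neq.

Lemma sval_continuous : continuous (sval : unit_interval -> R).
Proof. exact: (@initial_continuous _ _ (set_val : unit_interval -> R)). Qed.

Lemma clampI_continuous : continuous clampI.
Proof.
apply: continuous_comp_initial => x.
rewrite /comp /=.
apply: (@continuous_max _ _ (fun=> 0) (fun r : R => Num.min 1 r)).
  exact: cvg_cst.
apply: (@continuous_min _ _ (fun=> 1) (fun r : R => r)).
  exact: cvg_cst.
exact: cvg_id.
Qed.

End unit_interval.

Lemma continuous_compT (A B C : topologicalType) (f : A -> B) (g : B -> C) :
  continuous f -> continuous g -> continuous (fun x => g (f x)).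
Proof. by move=> cf cg x; apply: continuous_comp; [exact: cf|exact: cg]. Qed.

Lemma fstT_continuous (A B : topologicalType) : continuous (@fst A B).
Proof. by move=> x; exact: cvg_fst. Qed.

Lemma sndT_continuous (A B : topologicalType) : continuous (@snd A B).
Proof. by move=> x; exact: cvg_snd. Qed.

Lemma pairT_continuous (A B C : topologicalType) (f : A -> B) (g : A -> C) :
  continuous f -> continuous g -> continuous (fun x => (f x, g x)).
Proof. by move=> cf cg x; apply: cvg_pair; [exact: cf|exact: cg]. Qed.

Lemma affine_continuous (R : realType) (T : topologicalType) (u : T -> R)
  (c d : R) : continuous u -> continuous (fun t => c * u t + d).
Proof.
move=> cu t.
by apply: cvgD; [apply: cvgM; [exact: cvg_cst|exact: cu]|exact: cvg_cst].
Qed.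

Lemma scale_continuous (R : realType) (T : topologicalType) (u : T -> R)
  (c : R) : continuous u -> continuous (fun t => c * u t).
Proof.
by move=> /(@affine_continuous _ _ _ c 0); under eq_fun do rewrite addr0.
Qed.

Section paste.
Variables (T X : topologicalType) (R : realType).

Lemma paste_continuous (a : T -> R) (c : R) (f g : T -> X) :
  continuous a -> continuous f -> continuous g ->
  (forall t, a t = c -> f t = g t) ->
  continuous (fun t => if a t <= c then f t else g t).
Proof.
move=> ca cf cg fg.
pose A := a @^-1` [set r | r <= c]; pose B := a @^-1` [set r | c <= r].
have cA : closed A.
  by apply: closed_comp; [move=> ? _; exact: ca|exact: closed_le].
have cB : closed B.
  by apply: closed_comp; [move=> ? _; exact: ca|exact: closed_ge].
apply/continuous_subspace_setT.
have -> : [set: T] = A `|` B.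
  apply/seteqP; split => // t _; rewrite /A /B /=.
  by case: (leP (a t) c) => [|/ltW]; [left|right].
apply: withinU_continuous => //.
- apply: (@subspace_eq_continuous _ A _ f); last exact: continuous_subspaceT.
  by move=> t /set_mem; rewrite /A /from_subspace /= => ->.
- apply: (@subspace_eq_continuous _ B _ g); last exact: continuous_subspaceT.
  move=> t /set_mem; rewrite /B /from_subspace /= => ct; case: ifPn => // tc.
  by apply/esym/fg/le_anti; rewrite tc ct.
Qed.

End paste.

Section fundamental_group.
Variables (R : realType) (X : topologicalType).
Notation I := (unit_interval R).
Implicit Types x y z : X.

(* Homotopy of paths relative to their end points. *)
Definition path_homotopic x y (f g : {path I from x to y}) : Prop :=
  exists H : I * I -> X,
    [/\ continuous H,
        forall t, H (t, zero) = f t,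
        forall t, H (t, one) = g t,
        forall s, H (zero, s) = x &
        forall s, H (one, s) = y].


Lemma sval0 : sval (zero : I) = 0.
Proof. by rewrite clampIE // lexx ler01. Qed.

Lemma sval1 : sval (one : I) = 1.
Proof. by rewrite clampIE // lexx ler01. Qed.

Lemma path_homotopic_reparam x y (p q : {path I from x to y}) (f : I -> X)
    (a b : I -> R) :
  continuous f -> continuous a -> continuous b ->
  a zero = b zero -> a one = b one ->
  (forall t, p t = f (clampI (a t))) -> (forall t, q t = f (clampI (b t))) ->
  path_homotopic p q.
Proof.
move=> cf ca cb ab0 ab1 pE qE.
exists (fun w => f (clampI ((1 - sval w.2) * a w.1 + sval w.2 * b w.1))).
split.
- have k1 : continuous (fun w : I * I => sval w.2 : R).
    exact: continuous_compT (@sndT_continuous _ _) (@sval_continuous R).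
  have k2 : continuous (fun w : I * I => a w.1).
    exact: continuous_compT (@fstT_continuous _ _) ca.
  have k3 : continuous (fun w : I * I => b w.1).
    exact: continuous_compT (@fstT_continuous _ _) cb.
  apply: continuous_compT cf; apply: continuous_compT (@clampI_continuous R).
  move=> w; apply: cvgD; apply: cvgM;
    [apply: cvgB; [exact: cvg_cst|exact: k1]|exact: k2|exact: k1|exact: k3].
- by move=> t; lazy beta; rewrite sval0 pE subr0 mul1r mul0r addr0.
- by move=> t; lazy beta; rewrite sval1 qE subrr mul1r mul0r add0r.
- by move=> s; rewrite [(_, s).1]/= -ab0 -mulrDl subrK mul1r -pE path_zero.
- by move=> s; rewrite [(_, s).1]/= -ab1 -mulrDl subrK mul1r -pE path_one.
Qed.

Lemma clampI_affine_continuous (T : topologicalType) (u : T -> R) (c d : R) :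
  continuous u -> continuous (fun t => clampI (c * u t + d)).
Proof.
by move=> /(@affine_continuous _ _ _ c d) /continuous_compT; apply;
  exact: clampI_continuous.
Qed.

Definition path_mul_fun (f g : I -> X) (t : I) : X :=
  if sval t <= 2^-1 then f (clampI (2 * sval t))
  else g (clampI (2 * sval t - 1)).

Definition path_inv_fun (f : I -> X) (t : I) : X := f (clampI (1 - sval t)).

Section path_mul.
Variables (x y z : X) (f : {path I from x to y}) (g : {path I from y to z}).

Fact path_mul_continuous : continuous (path_mul_fun f g).
Proof.
apply: (@paste_continuous I X R sval 2^-1 (fun t => f (clampI (2 * sval t)))
  (fun t => g (clampI (2 * sval t - 1)))).
- exact: sval_continuous.
- apply: (@continuous_compT _ _ _ (fun t : I => clampI (2 * sval t)) f).
    have := @clampI_affine_continuous I sval 2 0 (@sval_continuous R).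
    by under eq_fun do rewrite addr0.
  exact: cts_fun.
- apply: (@continuous_compT _ _ _ (fun t : I => clampI (2 * sval t - 1)) g).
    exact: clampI_affine_continuous (@sval_continuous R).
  exact: cts_fun.
- move=> t ->; rewrite mulfV ?pnatr_eq0 // subrr.
  by rewrite -[clampI 1]/one -[clampI 0]/zero path_one path_zero.
Qed.

Fact path_mul_zero : path_mul_fun f g zero = x.
Proof.
by rewrite /path_mul_fun sval0 invr_ge0 ler0n mulr0 -[clampI 0]/zero path_zero.
Qed.

Fact path_mul_one : path_mul_fun f g one = z.
Proof.
rewrite /path_mul_fun sval1 ifF; last by apply/negbTE; rewrite -ltNge; lra.
by rewrite (_ : 2 * 1 - 1 = 1 :> R) -?[clampI 1]/one ?path_one //; lra.
Qed.

Definition path_mul : {path I from x to z} :=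
  mk_path path_mul_continuous path_mul_zero path_mul_one.

Lemma path_mulE t : path_mul t = if sval t <= 2^-1 then f (clampI (2 * sval t))
  else g (clampI (2 * sval t - 1)).
Proof. by []. Qed.

Fact path_inv_continuous : continuous (path_inv_fun f).
Proof.
apply: (@continuous_compT _ _ _ (fun t : I => clampI (1 - sval t)) f).
  have := @clampI_affine_continuous I sval (-1) 1 (@sval_continuous R).
  by under eq_fun do rewrite mulN1r addrC.
exact: cts_fun.
Qed.

Fact path_inv_zero : path_inv_fun f zero = y.
Proof. by rewrite /path_inv_fun sval0 subr0 -[clampI 1]/one path_one. Qed.

Fact path_inv_one : path_inv_fun f one = x.
Proof. by rewrite /path_inv_fun sval1 subrr -[clampI 0]/zero path_zero. Qed.

Definition path_inv : {path I from y to x} :=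
  mk_path path_inv_continuous path_inv_zero path_inv_one.

Lemma path_invE t : path_inv t = f (clampI (1 - sval t)).
Proof. by []. Qed.

End path_mul.

Definition path_cst x : {path I from x to x} := cst x.

Lemma path_homotopic_refl x y (f : {path I from x to y}) : path_homotopic f f.
Proof.
exists (fun w => f w.1); split => // [|s|s].
- exact: continuous_compT (@fstT_continuous _ _) (@cts_fun _ _ f).
- exact: path_zero.
- exact: path_one.
Qed.

Lemma path_homotopic_sym x y (f g : {path I from x to y}) :
  path_homotopic f g -> path_homotopic g f.
Proof.
move=> [H [cH H0 H1 Hx Hy]].
have cr : continuous (fun s : I => clampI (1 - sval s)).
  have := @clampI_affine_continuous I sval (-1) 1 (@sval_continuous R).
  by under eq_fun do rewrite mulN1r addrC.
exists (fun w => H (w.1, clampI (1 - sval w.2))); split => [|t|t|s|s].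
- apply: continuous_compT cH; apply: pairT_continuous.
    exact: fstT_continuous.
  exact: continuous_compT (@sndT_continuous _ _) cr.
- by lazy beta; rewrite sval0 subr0 -[clampI 1]/one H1.
- by lazy beta; rewrite sval1 subrr -[clampI 0]/zero H0.
- exact: Hx.
- exact: Hy.
Qed.

Lemma path_homotopic_trans x y (f g h : {path I from x to y}) :
  path_homotopic f g -> path_homotopic g h -> path_homotopic f h.
Proof.
move=> [H [cH H0 H1 Hx Hy]] [K [cK K0 K1 Kx Ky]].
exists (fun w => if sval w.2 <= 2^-1 then H (w.1, clampI (2 * sval w.2))
                 else K (w.1, clampI (2 * sval w.2 - 1))); split => [|t|t|s|s].
- have c2 : continuous (fun w : I * I => sval w.2 : R).
    exact: continuous_compT (@sndT_continuous _ _) (@sval_continuous R).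
  apply: (@paste_continuous _ X R (fun w : I * I => sval w.2) 2^-1
    (fun w => H (w.1, clampI (2 * sval w.2)))
    (fun w => K (w.1, clampI (2 * sval w.2 - 1)))) => //.
  + apply: continuous_compT cH; apply: pairT_continuous.
      exact: fstT_continuous.
    have := @clampI_affine_continuous _ _ 2 0 c2.
    by under eq_fun do rewrite addr0.
  + apply: continuous_compT cK; apply: pairT_continuous.
      exact: fstT_continuous.
    exact: clampI_affine_continuous.
  + move=> w; rewrite /= => ->; rewrite mulfV ?pnatr_eq0 // subrr.
    by rewrite -[clampI 1]/one -[clampI 0]/zero H1 K0.
- by lazy beta; rewrite sval0 invr_ge0 ler0n mulr0 -[clampI 0]/zero H0.
- lazy beta; rewrite sval1 ifF; last by apply/negbTE; rewrite -ltNge; lra.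
  by rewrite (_ : 2 * 1 - 1 = 1 :> R) -?[clampI 1]/one ?K1 //; lra.
- by lazy beta; rewrite !Hx !Kx if_same.
- by lazy beta; rewrite !Hy !Ky if_same.
Qed.

Lemma path_mul_homotopic x y z (f f' : {path I from x to y})
    (g g' : {path I from y to z}) :
  path_homotopic f f' -> path_homotopic g g' ->
  path_homotopic (path_mul f g) (path_mul f' g').
Proof.
move=> [H [cH H0 H1 Hx Hy]] [K [cK K0 K1 Kx Ky]].
exists (fun w => if sval w.1 <= 2^-1 then H (clampI (2 * sval w.1), w.2)
                 else K (clampI (2 * sval w.1 - 1), w.2)); split => [|t|t|s|s].
- have c1 : continuous (fun w : I * I => sval w.1 : R).
    exact: continuous_compT (@fstT_continuous _ _) (@sval_continuous R).
  apply: (@paste_continuous _ X R (fun w : I * I => sval w.1) 2^-1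
    (fun w => H (clampI (2 * sval w.1), w.2))
    (fun w => K (clampI (2 * sval w.1 - 1), w.2))) => //.
  + apply: continuous_compT cH; apply: pairT_continuous.
      have := @clampI_affine_continuous _ _ 2 0 c1.
      by under eq_fun do rewrite addr0.
    exact: sndT_continuous.
  + apply: continuous_compT cK; apply: pairT_continuous.
      exact: clampI_affine_continuous.
    exact: sndT_continuous.
  + move=> w; rewrite /= => ->; rewrite mulfV ?pnatr_eq0 // subrr.
    by rewrite -[clampI 1]/one -[clampI 0]/zero Hy Kx.
- by lazy beta; rewrite H0 K0.
- by lazy beta; rewrite H1 K1.
- by lazy beta; rewrite sval0 invr_ge0 ler0n mulr0 -[clampI 0]/zero Hx.
- lazy beta; rewrite sval1 ifF; last by apply/negbTE; rewrite -ltNge; lra.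
  by rewrite (_ : 2 * 1 - 1 = 1 :> R) -?[clampI 1]/one ?Ky //; lra.
Qed.

Lemma path_inv_homotopic x y (f f' : {path I from x to y}) :
  path_homotopic f f' -> path_homotopic (path_inv f) (path_inv f').
Proof.
move=> [H [cH H0 H1 Hx Hy]].
have cr : continuous (fun s : I => clampI (1 - sval s)).
  have := @clampI_affine_continuous I sval (-1) 1 (@sval_continuous R).
  by under eq_fun do rewrite mulN1r addrC.
exists (fun w => H (clampI (1 - sval w.1), w.2)); split => [|t|t|s|s].
- apply: continuous_compT cH; apply: pairT_continuous.
    exact: continuous_compT (@fstT_continuous _ _) cr.
  exact: sndT_continuous.
- exact: H0.
- exact: H1.
- by lazy beta; rewrite sval0 subr0 -[clampI 1]/one Hy.
- by lazy beta; rewrite sval1 subrr -[clampI 0]/zero Hx.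
Qed.

Lemma path_mulA x y z w (f : {path I from x to y}) (g : {path I from y to z})
    (h : {path I from z to w}) :
  path_homotopic (path_mul f (path_mul g h)) (path_mul (path_mul f g) h).
Proof.
apply: (@path_homotopic_reparam _ _ _ _ (path_mul f (path_mul g h)) sval
  (fun t => if sval t <= 2^-1 then
              if sval t <= 4^-1 then 2 * sval t else 1 * sval t + 4^-1
            else 2^-1 * sval t + 2^-1)).
- exact: cts_fun.
- exact: sval_continuous.
- have cs := @sval_continuous R.
  apply: (@paste_continuous I R R sval 2^-1 (fun t =>
    if sval t <= 4^-1 then 2 * sval t else 1 * sval t + 4^-1)
    (fun t => 2^-1 * sval t + 2^-1)) => //.
  + apply: (@paste_continuous I R R sval 4^-1 (fun t => 2 * sval t)
      (fun t => 1 * sval t + 4^-1)) => //.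
    * exact: scale_continuous.
    * exact: affine_continuous.
    * by move=> t ->; lra.
  + exact: affine_continuous.
  + by move=> t ->; case: ifPn => // ?; lra.
- by rewrite sval0; repeat case: ifPn => ?; lra.
- by rewrite sval1; repeat case: ifPn => ?; lra.
- by move=> t; rewrite clampIK.
- move=> t; have /andP[t0 t1] := unit_intervalP t.
  rewrite !path_mulE.
  case: (leP (sval t) 2^-1) => t2; last first.
    rewrite (@clampIE _ (2^-1 * sval t + 2^-1)); last lra.
    case: leP => [?|_]; first by exfalso; lra.
    rewrite (@clampIE _ (2 * (2^-1 * sval t + 2^-1) - 1)); last lra.
    by case: leP => [?|_]; [exfalso; lra|congr (h (clampI _)); lra].
  rewrite (@clampIE _ (2 * sval t)); last lra.
  case: (leP (sval t) 4^-1) => t4.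
    rewrite clampIE; last lra.
    by case: leP => [_|?]; last by exfalso; lra.
  rewrite (@clampIE _ (1 * sval t + 4^-1)); last lra.
  case: leP => [?|_]; first by exfalso; lra.
  case: leP => [?|_]; first by exfalso; lra.
  rewrite (@clampIE _ (2 * (1 * sval t + 4^-1) - 1)); last lra.
  by case: leP => [_|?]; [congr (g (clampI _)); lra|exfalso; lra].
Qed.

Lemma path_mul1l x y (f : {path I from x to y}) :
  path_homotopic (path_mul (path_cst x) f) f.
Proof.
have cs := @sval_continuous R.
apply: (@path_homotopic_reparam _ _ _ _ f
  (fun t => if sval t <= 2^-1 then 0 else 2 * sval t - 1) sval) => //.
- exact: cts_fun.
- apply: (@paste_continuous I R R sval 2^-1 (fun=> 0)
    (fun t => 2 * sval t - 1)) => //.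
  + exact: cst_continuous.
  + exact: affine_continuous.
  + by move=> t ->; lra.
- by rewrite sval0; case: leP => ?; lra.
- by rewrite sval1; case: leP => ?; lra.
- move=> t; rewrite !path_mulE.
  by case: leP => // _; rewrite -[clampI 0]/zero path_zero.
- by move=> t; rewrite clampIK.
Qed.

Lemma path_mul1r x y (f : {path I from x to y}) :
  path_homotopic (path_mul f (path_cst y)) f.
Proof.
have cs := @sval_continuous R.
apply: (@path_homotopic_reparam _ _ _ _ f
  (fun t => if sval t <= 2^-1 then 2 * sval t else 1) sval) => //.
- exact: cts_fun.
- apply: (@paste_continuous I R R sval 2^-1 (fun t => 2 * sval t)
    (fun=> 1)) => //.
  + exact: scale_continuous.
  + exact: cst_continuous.
  + by move=> t ->; lra.
- by rewrite sval0; case: leP => ?; lra.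
- by rewrite sval1; case: leP => ?; lra.
- move=> t; rewrite !path_mulE.
  by case: leP => // _; rewrite -[clampI 1]/one path_one.
- by move=> t; rewrite clampIK.
Qed.

Lemma path_mulV x y (f : {path I from x to y}) :
  path_homotopic (path_mul f (path_inv f)) (path_cst x).
Proof.
have cs := @sval_continuous R.
apply: (@path_homotopic_reparam _ _ _ _ f
  (fun t => if sval t <= 2^-1 then 2 * sval t else - 2 * sval t + 2)
  (fun=> 0)).
- exact: cts_fun.
- apply: (@paste_continuous I R R sval 2^-1 (fun t => 2 * sval t)
    (fun t => - 2 * sval t + 2)) => //.
  + exact: scale_continuous.
  + exact: affine_continuous.
  + by move=> t ->; lra.
- exact: cst_continuous.
- by rewrite sval0; case: leP => ?; lra.
- by rewrite sval1; case: leP => ?; lra.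
- move=> t; have /andP[t0 t1] := unit_intervalP t.
  rewrite path_mulE path_invE.
  case: leP => // t2; rewrite clampIE; last lra.
  by congr (f (clampI _)); lra.
- by move=> t; rewrite -[clampI 0]/zero path_zero.
Qed.

Lemma path_invK x y (f : {path I from x to y}) : path_inv (path_inv f) = f.
Proof.
apply/path_eqP => t; have /andP[t0 t1] := unit_intervalP t.
rewrite !path_invE clampIE; last lra.
by rewrite subKr clampIK.
Qed.

Lemma path_mulVl x y (f : {path I from x to y}) :
  path_homotopic (path_mul (path_inv f) f) (path_cst y).
Proof. by rewrite -{2}[f]path_invK; exact: path_mulV. Qed.

End fundamental_group.

Section fundamental_group_structure.
Variables (R : realType) (X : topologicalType) (x : X).
Notation I := (unit_interval R).
Notation loop := {path I from x to x}.

Let loop_rel (f g : loop) : bool := `[< path_homotopic f g >].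

Fact loop_rel_refl : reflexive loop_rel.
Proof. by move=> f; apply/asboolP; exact: path_homotopic_refl. Qed.

Fact loop_rel_sym : symmetric loop_rel.
Proof. by move=> f g; apply/asboolP/asboolP; exact: path_homotopic_sym. Qed.

Fact loop_rel_trans : transitive loop_rel.
Proof.
move=> g f h /asboolP fg /asboolP gh; apply/asboolP.
exact: path_homotopic_trans fg gh.
Qed.

Definition loop_equiv : equiv_rel loop :=
  EquivRel loop_rel loop_rel_refl loop_rel_sym loop_rel_trans.

Definition fundamental_group : Type := {eq_quot loop_equiv}.

HB.instance Definition _ := Choice.on fundamental_group.
HB.instance Definition _ := Quotient.on fundamental_group.

Definition loop_class (f : loop) : fundamental_group := \pi_fundamental_group f.

Lemma loop_classP (f g : loop) :
  loop_class f = loop_class g <-> path_homotopic f g.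
Proof.
by split=> [/eqmodP/asboolP //|fg]; apply/eqmodP/asboolP.
Qed.

Lemma repr_loop_class (f : loop) :
  path_homotopic (repr (loop_class f) : loop) f.
Proof. by apply/loop_classP; rewrite /loop_class reprK. Qed.

Definition pi1_mul (a b : fundamental_group) : fundamental_group :=
  loop_class (path_mul (repr a) (repr b)).
Definition pi1_inv (a : fundamental_group) : fundamental_group :=
  loop_class (path_inv (repr a)).
Definition pi1_one : fundamental_group := loop_class (path_cst R x).

Lemma pi1_mulE (f g : loop) :
  pi1_mul (loop_class f) (loop_class g) = loop_class (path_mul f g).
Proof. by apply/loop_classP/path_mul_homotopic; exact: repr_loop_class. Qed.

Lemma pi1_invE (f : loop) : pi1_inv (loop_class f) = loop_class (path_inv f).
Proof. by apply/loop_classP/path_inv_homotopic; exact: repr_loop_class. Qed.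

Lemma loop_class_surj (a : fundamental_group) : exists f, a = loop_class f.
Proof. by exists (repr a); rewrite /loop_class reprK. Qed.

Fact pi1_mulA : associative pi1_mul.
Proof.
move=> a b c; have [f ->] := loop_class_surj a.
have [g ->] := loop_class_surj b; have [h ->] := loop_class_surj c; rewrite !pi1_mulE.
by apply/loop_classP; exact: path_mulA.
Qed.

Fact pi1_mul1g : left_id pi1_one pi1_mul.
Proof.
move=> a; have [f ->] := loop_class_surj a; rewrite pi1_mulE.
by apply/loop_classP; exact: path_mul1l.
Qed.

Fact pi1_mulg1 : right_id pi1_one pi1_mul.
Proof.
move=> a; have [f ->] := loop_class_surj a; rewrite pi1_mulE.
by apply/loop_classP; exact: path_mul1r.
Qed.

Fact pi1_mulVg : left_inverse pi1_one pi1_inv pi1_mul.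
Proof.
move=> a; have [f ->] := loop_class_surj a; rewrite pi1_invE pi1_mulE.
by apply/loop_classP; exact: path_mulVl.
Qed.

Fact pi1_mulgV : right_inverse pi1_one pi1_inv pi1_mul.
Proof.
move=> a; have [f ->] := loop_class_surj a; rewrite pi1_invE pi1_mulE.
by apply/loop_classP; exact: path_mulV.
Qed.

HB.instance Definition _ := isGroup.Build fundamental_group
  pi1_mulA pi1_mul1g pi1_mulg1 pi1_mulVg pi1_mulgV.

End fundamental_group_structure.

Definition path_connected (R : realType) (X : topologicalType) : Prop :=
  forall x y : X, inhabited {path unit_interval R from x to y}.

(* The pair (e, false), resp. (e, true), is the initial, resp. terminal, end of
   the edge e for an arbitrary orientation of e, and endpoint sends an end of
   an edge to the vertex at which it is attached.  An end also stands for the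
   edge traversed starting from that end. *)
Record multigraph := Multigraph {
  vertex : choiceType;
  edge : choiceType;
  endpoint : edge * bool -> vertex
}.

Definition edge_end (Gamma : multigraph) : choiceType :=
  (edge Gamma * bool)%type.

Definition opposite_end (Gamma : multigraph) (h : edge_end Gamma) :
  edge_end Gamma := (h.1, ~~ h.2).

Definition adjacent (Gamma : multigraph) (v w : vertex Gamma) : Prop :=
  exists h : edge_end Gamma, endpoint h = v /\ endpoint (opposite_end h) = w.

Definition connected_graph (Gamma : multigraph) : Prop :=
  inhabited (vertex Gamma) /\
  forall v w : vertex Gamma, clos_refl_trans _ (@adjacent Gamma) v w.

(* The boundary cycle of the polygon p has the vertices and the edges
   0, ..., polygon_size p - 1, its edge i running from the vertex i to the
   vertex i + 1 modulo polygon_size p; this edge is attached along the oriented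
   edge attach p i. *)
Record two_complex := TwoComplex {
  skeleton :> multigraph;
  polygon : choiceType;
  polygon_size : polygon -> nat;
  polygon_size_gt0 : forall p, (0 < polygon_size p)%N;
  attach : forall p, 'I_(polygon_size p) -> edge_end skeleton;
  attach_closed : forall p (i : 'I_(polygon_size p)),
    endpoint (opposite_end (attach i)) = endpoint (attach (ordS i))
}.

Section link.
Variable K : two_complex.

Definition polygon_vertex : choiceType :=
  {p : polygon K & 'I_(polygon_size p)}.

Definition polygon_vertex_image (c : polygon_vertex) : vertex K :=
  endpoint (attach (tagged c)).

(* The images in the 1-skeleton of the two ends of boundary edges that meet at
   the vertex i of a polygon: the start of the edge i (false) and the end of
   the edge i - 1 (true). *)
Definition corner_end (c : polygon_vertex * bool) : edge_end K :=
  if c.2 then opposite_end (attach (ord_pred (tagged c.1)))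
  else attach (tagged c.1).

Definition polygon_quotient : Prop :=
  (forall v : vertex K, exists h : edge_end K, endpoint h = v) /\
  (forall e : edge K, exists (p : polygon K) (i : 'I_(polygon_size p)),
     (attach i).1 = e).

Section link_at.
Variable u : vertex K.

(* Two ends of polygon edges are identified when they have the same image, so
   the classes of identified ends are represented by these images. *)
Definition link_vertex_set : set (edge_end K) :=
  [set h | exists c : polygon_vertex * bool,
     polygon_vertex_image c.1 = u /\ corner_end c = h].

Definition link_vertex : choiceType := set_type link_vertex_set.

Definition link_edge : choiceType :=
  set_type [set c : polygon_vertex | polygon_vertex_image c = u].

Fact link_endpoint_subproof (c : link_edge * bool) :
  corner_end (sval c.1, c.2) \in link_vertex_set.
Proof.
by apply/mem_set; exists (sval c.1, c.2); split => //; exact: set_valP c.1.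
Qed.

Definition link_endpoint (c : link_edge * bool) : link_vertex :=
  exist (fun h => h \in link_vertex_set) _ (link_endpoint_subproof c).

Definition link : multigraph := Multigraph link_endpoint.

End link_at.

Definition link_connected : Prop :=
  polygon_quotient /\ forall u : vertex K, connected_graph (link u).

End link.

Section realization.
Variable R : realType.

Definition disc_set : set (R * R) := [set z | z.1 ^+ 2 + z.2 ^+ 2 <= 1].

Definition disc : topologicalType := set_type disc_set.

Definition circle : topologicalType :=
  set_type [set z : R * R | z.1 ^+ 2 + z.2 ^+ 2 = 1].

Fact disc_boundary_subproof (a : R) :
  (cos a, sin a) \in disc_set.
Proof. by apply/mem_set; rewrite /disc_set /= cos2Dsin2. Qed.

(* The point at parameter t of the edge i of the boundary of an n-gon, the
   boundary circle being divided into n equal arcs. *)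
Definition disc_boundary (n : nat) (i : 'I_n) (t : unit_interval R) : disc :=
  exist (fun z : R * R => z \in disc_set) _
    (disc_boundary_subproof (2 * pi * (i%:R + sval t) / n%:R)).

Variable K : two_complex.

Definition cell : choiceType := (vertex K + edge K + polygon K)%type.

Definition closed_cell (c : cell) : topologicalType :=
  match c with
  | inl (inl _) => discrete_topology unit
  | inl (inr _) => unit_interval R
  | inr _ => disc
  end.

Definition cells : topologicalType := {c : cell & closed_cell c}.

Definition vertex_point (v : vertex K) : cells :=
  existT closed_cell (inl (inl v)) tt.
Definition edge_point (e : edge K) (t : unit_interval R) : cells :=
  existT closed_cell (inl (inr e)) t.
Definition polygon_point (p : polygon K) (z : disc) : cells :=
  existT closed_cell (inr p) z.

(* The point at parameter t of the edge starting from the end h. *)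
Definition oriented_edge_point (h : edge_end K) (t : unit_interval R) : cells :=
  edge_point h.1 (if h.2 then clampI (1 - sval t) else t).

Inductive glued : cells -> cells -> Prop :=
| glued_edge (h : edge_end K) :
    glued (oriented_edge_point h zero) (vertex_point (endpoint h))
| glued_polygon (p : polygon K) (i : 'I_(polygon_size p))
    (t : unit_interval R) :
    glued (polygon_point p (disc_boundary i t))
          (oriented_edge_point (attach i) t).

Let glue_rel (a b : cells) : bool := `[< clos_refl_sym_trans _ glued a b >].

Fact glue_rel_refl : reflexive glue_rel.
Proof. by move=> a; apply/asboolP; exact: rst_refl. Qed.

Fact glue_rel_sym : symmetric glue_rel.
Proof. by move=> a b; apply/asboolP/asboolP; exact: rst_sym. Qed.

Fact glue_rel_trans : transitive glue_rel.
Proof.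
by move=> b a c /asboolP ab /asboolP bc; apply/asboolP; exact: rst_trans ab bc.
Qed.

Definition glue_equiv : equiv_rel cells :=
  EquivRel glue_rel glue_rel_refl glue_rel_sym glue_rel_trans.

Definition realization : Type := {eq_quot glue_equiv}.

HB.instance Definition _ :=
  Topological.copy realization (quotient_topology {eq_quot glue_equiv}).
HB.instance Definition _ := Quotient.on realization.

Definition realization_vertex (v : vertex K) : realization :=
  \pi_realization (vertex_point v).

End realization.

Inductive wedge_factor (R : realType) : Type :=
| CircleFactor (x : circle R)
| ComplexFactor (K : two_complex) (_ : link_connected K)
    (_ : path_connected R (realization R K)) (v : vertex K).

Section wedge_product.
Variables (R : realType) (I : choiceType) (F : I -> wedge_factor R).

Definition factor_space (f : wedge_factor R) : topologicalType :=
  match f with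
  | CircleFactor _ => circle R
  | ComplexFactor K _ _ _ => realization R K
  end.

Definition factor_base (f : wedge_factor R) : factor_space f :=
  match f with
  | CircleFactor x => x
  | ComplexFactor K _ _ v => realization_vertex R v
  end.

(* A one-point space is added to the family, which provides the base point and
   makes the wedge of the empty family a point; it does not change the wedge of
   a nonempty family. *)
Definition pointed_family_space (o : option I) : topologicalType :=
  if o is Some i then factor_space (F i) else discrete_topology unit.

Definition pointed_family_base (o : option I) : pointed_family_space o :=
  match o with
  | Some i => factor_base (F i)
  | None => tt
  end.

Definition wedge_product : topologicalType := wedge pointed_family_base.

Definition wedge_base : wedge_product :=
  wedge_lift pointed_family_base (i := None) tt.

End wedge_product.

(* Main.v *)
(* The complex has one vertex, an edge for each element of G, and a polygon for
   each closed walk v_0, ..., v_n in G, the edge i of which is the loop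
   v_i^-1 v_{i+1}; the triangles (1, g, gh) make every outgoing end adjacent to
   every incoming end in the link.  In polar coordinates the space is a quotient
   of squares, one for each side of a polygon.  It is covered by the open stars
   of the vertex, of the edges and of the faces; on them the walks define labels
   in G whose quotients are locally constant, hence a holonomy of paths in G.
   Each star contracts linearly in the squares, so that a short path is
   homotopic to the way out to the centre of a star and back; therefore the
   class of a loop is the class of the edge labelled by its holonomy. *)
From HB Require Import structures.
From Stdlib Require Import Relation_Operators.
Require Import Defs.
From mathcomp Require Import all_boot all_order all_algebra generic_quotient.
From mathcomp Require Import all_classical all_reals all_analysis.
From mathcomp Require Import homotopy lra ring.
Import Order.TTheory GRing.Theory Num.Theory.
Import numFieldNormedType.Exports.

Set Implicit Arguments.
Unset Strict Implicit.
Unset Printing Implicit Defensive.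

Local Open Scope classical_set_scope.
Local Open Scope ring_scope.
Local Open Scope quotient_scope.

(** * The unit interval *)

(** The isomorphism is the holonomy itself, and its bijectivity rests on one formula: a path from x
    to y has class u(x)^-1 psi(h) u(y), where h is its holonomy, psi(g) is the class of the edge g,
    and u(x) is the class of a chosen, discontinuous way from the base point to x. For a loop both
    outer factors are u at the base point, so that equal holonomies force homotopic loops; the edges
    themselves attain every value. The formula needs psi to be a morphism, and this is the only
    relation that has to be read off the polygons. Both sides of the formula are multiplicative
    under subdivision, so it is enough to check it on short paths; this replaces a decomposition of
    the whole space. Polygons are walks rather than words with trivial product because their
    vertices label the corners directly. All computations use only an interface of squares that both
    the complex and the wedge satisfy. The group of the wedge is therefore computed directly,
    without comparing it with that of its factor. *)

Lemma injective_hausdorff (T U : topologicalType) (f : T -> U) :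
  continuous f -> injective f -> hausdorff_space U -> hausdorff_space T.
Proof.
move=> cf injf hU p q pq; apply: injf; apply: hU => A B fpA fqB.
by have [z [/= Az Bz]] := pq _ _ (cf _ _ fpA) (cf _ _ fqB); exists (f z).
Qed.

Lemma compact_locally_compact (T : topologicalType) :
  compact [set: T] -> locally_compact [set: T].
Proof.
move=> cT x _; exists [set: T]; first exact: filterT.
by split => //; exact: closedT.
Qed.

Section interval.
Variable R : realType.
Notation I := (unit_interval R).

Lemma clampI_image : [set: I] = @clampI R @` `[0, 1].
Proof.
apply/seteqP; split => // t _; exists (sval t); last exact: clampIK.
by rewrite /= in_itv /= unit_intervalP.
Qed.

Lemma unit_interval_compact : compact [set: I].
Proof.
rewrite clampI_image; apply: continuous_compact (@segment_compact R 0 1).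
exact/continuous_subspaceT/clampI_continuous.
Qed.

Lemma unit_interval_hausdorff : hausdorff_space I.
Proof.
apply: (injective_hausdorff (@sval_continuous R)); last exact: Rhausdorff.
by move=> x y e; apply: val_inj.
Qed.

Lemma unit_interval_connected : connected [set: I].
Proof.
rewrite clampI_image.
apply: connected_continuous_connected (@segment_connected R 0 1) _.
exact/continuous_subspaceT/clampI_continuous.
Qed.

(** By symmetry and transitivity each class [P x] is open and closed, so connectedness makes it
    everything. This takes the place of subdivisions of the interval by a Lebesgue number. *)
Lemma unit_interval_rel_total (P : I -> I -> Prop) :
  (forall x y, P x y -> P y x) -> (forall x y z, P x y -> P y z -> P x z) ->
  (forall x, \forall y \near x, P x y) -> forall x y, P x y.
Proof.
move=> Psym Ptrans Ploc x y.
suff -> : P x = setT by [].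
have Pnbhs z : nbhs z (P z) by exact: Ploc.
have Prefl z : P z z by exact: nbhs_singleton (Pnbhs z).
apply: unit_interval_connected; first by exists x; exact: Prefl.
- exists (P x); last by rewrite setTI.
  rewrite openE => z Pxz; rewrite /interior.
  by apply: filterS (Pnbhs z) => w; exact: Ptrans.
- exists (P x); last by rewrite setTI.
  rewrite -[P x]setCK; apply: open_closedC; rewrite openE => z Pxz.
  rewrite /interior; apply: filterS (Pnbhs z) => w Pzw Pxw.
  by apply: Pxz; apply: Ptrans Pxw _; exact: Psym.
Qed.

Lemma unit_interval_nbhsP (x : I) (N : set I) : nbhs x N ->
  exists2 e : R, 0 < e & forall y, `|sval x - sval y| < e -> N y.
Proof.
move=> Nx; have : nbhs (sval x) (@clampI R @^-1` N).
  by apply: clampI_continuous; rewrite clampIK.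
move=> /nbhs_ballP[e e0 eN]; exists e => // y xy.
by rewrite -(clampIK y); apply: eN.
Qed.

Lemma unit_interval_nbhs_ball (x : I) (e : R) : 0 < e ->
  \forall y \near x, `|sval x - sval y| < e.
Proof.
move=> e0; have : nbhs (sval x) (ball (sval x) e) by exact: nbhsx_ballx.
by move/sval_continuous.
Qed.

(** The clamp never truncates, by convexity ([segmentE]); it only provides the membership proof. *)
Definition segment (x y t : I) : I :=
  clampI ((sval y - sval x) * sval t + sval x).

Lemma segmentE (x y t : I) :
  sval (segment x y t) = (sval y - sval x) * sval t + sval x.
Proof.
have /andP[x0 x1] := unit_intervalP x; have /andP[y0 y1] := unit_intervalP y.
have /andP[t0 t1] := unit_intervalP t.
have h1 : 0 <= sval t * sval y by exact: mulr_ge0.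
have h2 : 0 <= (1 - sval t) * sval x by apply: mulr_ge0; lra.
have h3 : 0 <= sval t * (1 - sval y) by apply: mulr_ge0; lra.
have h4 : 0 <= (1 - sval t) * (1 - sval x) by apply: mulr_ge0; lra.
by rewrite clampIE //; apply/andP; split; lra.
Qed.

Lemma segment_continuous (x y : I) : continuous (segment x y).
Proof. exact: clampI_affine_continuous (@sval_continuous R). Qed.

Lemma segment0 (x y : I) : segment x y zero = x.
Proof. by rewrite /segment sval0 mulr0 add0r clampIK. Qed.

Lemma segment1 (x y : I) : segment x y one = y.
Proof. by rewrite /segment sval1 mulr1 subrK clampIK. Qed.

Lemma segmentxx (x t : I) : segment x x t = x.
Proof. by rewrite /segment subrr mul0r add0r clampIK. Qed.

Lemma segment01 (t : I) : segment zero one t = t.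
Proof. by rewrite /segment sval0 sval1 subr0 mul1r addr0 clampIK. Qed.

Lemma segment_within (x y z t : I) (e : R) :
  `|sval z - sval x| < e -> `|sval z - sval y| < e ->
  `|sval z - sval (segment x y t)| < e.
Proof.
rewrite segmentE => zx zy; have /andP[t0 t1] := unit_intervalP t.
have -> : sval z - ((sval y - sval x) * sval t + sval x) =
  (1 - sval t) * (sval z - sval x) + sval t * (sval z - sval y) by ring.
have [-> /=|tn0] := eqVneq (sval t) 0; first by rewrite subr0 mul1r mul0r addr0.
have tp : 0 < sval t by rewrite lt_neqAle eq_sym tn0.
apply: le_lt_trans (ler_normD _ _) _.
rewrite !normrM (ger0_norm t0) ger0_norm ?subr_ge0 //.
have h1 : 0 <= (1 - sval t) * (e - `|sval z - sval x|) by apply: mulr_ge0; lra.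
have h2 : 0 < sval t * (e - `|sval z - sval y|) by apply: mulr_gt0; lra.
lra.
Qed.

End interval.

(** * Holonomy *)

Lemma continuous_near (T U : topologicalType) (f : T -> U) (P : U -> Prop) t :
  continuous f -> (\forall y \near f t, P y) -> \forall x \near t, P (f x).
Proof. by move=> cf /cf. Qed.

Section holonomy.
Variables (R : realType) (Y : topologicalType) (G : groupType).
Variables (J : Type) (W : J -> set Y) (s : J -> Y -> G).
Notation I := (unit_interval R).
Hypothesis W_open : forall j, open (W j).
Hypothesis W_cover : forall y, exists j, W j y.
Hypothesis s_locally_constant : forall i j y, W i y -> W j y ->
  \forall z \near y, (s i z * (s j z)^-1 = s i y * (s j y)^-1)%g.

(* The functions s j are the trivializations over the open sets W j of a flat
   bundle with group G; a lift of f is a parallel section of its pullback. *)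
Definition lift_upto (f : I -> Y) (a : R) (L : I -> G) :=
  forall (t : I) j, sval t <= a -> W j (f t) -> \forall t' \near t,
    sval t' <= a -> (L t' * (s j (f t'))^-1 = L t * (s j (f t))^-1)%g.

Lemma lift_extend (f : I -> Y) (j : J) (a b : I) (L : I -> G) :
  continuous f -> sval a <= sval b ->
  (forall t : I, sval a <= sval t <= sval b -> W j (f t)) ->
  lift_upto f (sval a) L -> exists L', lift_upto f (sval b) L'.
Proof.
move=> cf ab fW fL.
(* The left factor for which the translate [c * s j] of the local section agrees with [L] at [a], so
   that it can continue [L] beyond [a]. *)
pose c := (L a * (s j (f a))^-1)%g.
exists (fun t => if sval t <= sval a then L t else c * s j (f t))%g => t i tb fti.
have eqc (t' : I) : sval a <= sval t' -> sval t' <= sval b -> W i (f t') ->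
    \forall z \near t', (c * s j (f z) * (s i (f z))^-1 =
                         c * s j (f t') * (s i (f t'))^-1)%g.
  move=> at' t'b Wit'; have Wj : W j (f t') by apply: fW; rewrite at'.
  apply: filterS (continuous_near cf (s_locally_constant Wj Wit')) => z /= e.
  by rewrite -!mulgA e.
have [ta|ta|ta] := ltgtP (sval t) (sval a).
- have e0 : 0 < sval a - sval t by rewrite subr_gt0.
  have := fL t i (ltW ta) fti.
  apply: filterS2 (unit_interval_nbhs_ball t e0) => t' + H _.
  rewrite ltr_norml => /andP[h _].
  have t'a : sval t' <= sval a by lra.
  by rewrite t'a (H t'a).
- have e0 : 0 < sval t - sval a by rewrite subr_gt0.
  have := eqc t (ltW ta) tb fti.
  apply: filterS2 (unit_interval_nbhs_ball t e0) => t' + H _.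
  rewrite ltr_norml => /andP[_ h].
  by rewrite ifF; [exact: H|apply/negbTE; rewrite -ltNge; lra].
- have ea : t = a by apply: val_inj.
  subst t; have := eqc a (lexx _) ab fti.
  apply: filterS2 (fL a i (lexx _) fti) => t' H1 H2 _.
  case: ifPn => [/H1 //|_]; rewrite H2 /c.
  by rewrite -(mulgA (L a)) mulVg mulg1.
Qed.

Lemma lift_upto_le (f : I -> Y) (a b : R) (L : I -> G) :
  a <= b -> lift_upto f b L -> lift_upto f a L.
Proof.
move=> ab fL t j ta fWt.
apply: filterS (fL t j (le_trans ta ab) fWt) => t' + t'a; apply.
exact: le_trans t'a ab.
Qed.

Definition is_lift (T : topologicalType) (f : T -> Y) (L : T -> G) :=
  forall t j, W j (f t) -> \forall t' \near t,
    (L t' * (s j (f t'))^-1 = L t * (s j (f t))^-1)%g.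

(** Having a lift up to [a] and having one up to [b] are equivalent for [b] near [a], hence for all
    [a] and [b]; up to 0 any constant is a lift. *)
Lemma lift_exists (f : I -> Y) : continuous f -> exists L, is_lift f L.
Proof.
move=> cf; pose P (a : I) := exists L, lift_upto f (sval a) L.
suff [L fL] : P one.
  exists L => t j fWt; have t1 : sval t <= sval (one : I).
    by rewrite sval1; case/andP: (unit_intervalP t).
  apply: filterS (fL t j t1 fWt) => t'; apply.
  by rewrite sval1; case/andP: (unit_intervalP t').
suff: P zero <-> P one.
  move=> [+ _]; apply; exists (fun=> 1%g) => t j t0 fWt.
  have zE (z : I) : sval z <= sval (zero : I) -> z = zero.
    rewrite sval0 => z0; rewrite -(clampIK z) -[zero]/(clampI 0).
    congr clampI; apply: le_anti; rewrite z0.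
    by case/andP: (unit_intervalP z).
  by rewrite (zE t t0); near=> t' => /zE ->.
apply: (@unit_interval_rel_total R (fun a b => P a <-> P b)) =>
  [a b ->//|a b c -> //|x].
have [j Wx] := W_cover (f x).
have /unit_interval_nbhsP[e e0 eW] : nbhs x (f @^-1` W j).
  by apply: cf; apply: open_nbhs_nbhs.
apply: filterS (unit_interval_nbhs_ball x e0) => y xy.
have step (a b : I) : sval a <= sval b ->
    (forall t : I, sval a <= sval t <= sval b -> W j (f t)) -> P a <-> P b.
  move=> ab abW; split=> -[L fL]; first exact: lift_extend abW fL.
  by exists L; exact: lift_upto_le ab fL.
move: xy; rewrite ltr_norml => /andP[h1 h2].
have [xy|/ltW yx] := leP (sval x) (sval y); [|apply: iff_sym];
  by apply: step => // t /andP[??]; apply: eW; rewrite ltr_norml; lra.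
Unshelve. all: by end_near.
Qed.

Lemma is_lift_comp (T U : topologicalType) (f : T -> Y) (L : T -> G) (g : U -> T) :
  continuous g -> is_lift f L -> is_lift (f \o g) (L \o g).
Proof. by move=> cg fL t j /fL /cg. Qed.

Lemma is_lift_local (T : topologicalType) (f : T -> Y) (j : J) :
  continuous f -> (forall t, W j (f t)) -> is_lift f (s j \o f).
Proof.
move=> cf fW t i fWt.
exact: cf t _ (s_locally_constant (fW t) fWt).
Qed.

(** Two lifts differ by a left factor that is locally constant, hence constant on the interval; it
    cancels in the quotient of two values. *)
Lemma is_lift_unique (f : I -> Y) (L L' : I -> G) (x y : I) :
  is_lift f L -> is_lift f L' -> ((L x)^-1 * L y = (L' x)^-1 * L' y)%g.
Proof.
move=> fL fL'.
have e : (L' x * (L x)^-1 = L' y * (L y)^-1)%g.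
  move: x y; apply: unit_interval_rel_total => [//|x y z -> //|x].
  have [j Wj] := W_cover (f x).
  apply: filterS2 (fL _ _ Wj) (fL' _ _ Wj) => y e e'.
  have : ((L' y * (s j (f y))^-1) * (L y * (s j (f y))^-1)^-1 =
          (L' x * (s j (f x))^-1) * (L x * (s j (f x))^-1)^-1)%g by rewrite e e'.
  by rewrite !invgM !invgK !mulgA !mulgVK.
have -> : (L' y = L' x * (L x)^-1 * L y)%g by rewrite e mulgVK.
by rewrite -mulgA mulKg.
Qed.

(** The default lift 1 lets the multiplicativity and the inversion below hold for every function,
    continuous or not. *)
Definition holonomy (f : I -> Y) (x y : I) : G :=
  let L := xget (fun=> 1%g : G) [set L | is_lift f L] in ((L x)^-1 * L y)%g.

Lemma holonomyE (f : I -> Y) (L : I -> G) (x y : I) : is_lift f L ->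
  holonomy f x y = ((L x)^-1 * L y)%g.
Proof.
move=> fL; apply: is_lift_unique (fL).
by apply: (@xgetPex _ _ [set L | is_lift f L]); exists L.
Qed.

Lemma holonomyM (f : I -> Y) (x y z : I) :
  (holonomy f x y * holonomy f y z = holonomy f x z)%g.
Proof. by rewrite /holonomy -!mulgA mulVKg. Qed.

Lemma holonomy_comp (f : I -> Y) (g : I -> I) (x y : I) :
  continuous f -> continuous g ->
  holonomy (f \o g) x y = holonomy f (g x) (g y).
Proof.
move=> cf cg; have [L fL] := lift_exists cf.
by rewrite (holonomyE _ _ fL) (holonomyE _ _ (is_lift_comp cg fL)).
Qed.

Lemma holonomy_local (f : I -> Y) (x y : I) (j : J) : continuous f ->
  (forall t, W j (f (segment x y t))) ->
  holonomy f x y = ((s j (f x))^-1 * s j (f y))%g.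
Proof.
move=> cf fW; have cs := @segment_continuous R x y.
have := holonomy_comp zero one cf cs; rewrite segment0 segment1 => <-.
rewrite (@holonomyE _ (s j \o (f \o segment x y))) /=.
  by rewrite segment0 segment1.
by apply: is_lift_local => //; exact: continuous_compT.
Qed.

Lemma holonomyV (f : I -> Y) (x y : I) : holonomy f y x = ((holonomy f x y)^-1)%g.
Proof. by rewrite /holonomy invgM invgK. Qed.

Let rectangle (H : I * I -> Y) (a b c d : I) :=
  (holonomy (fun t => H (t, c)) a b * holonomy (fun u => H (b, u)) c d =
   holonomy (fun u => H (a, u)) c d * holonomy (fun t => H (t, d)) a b)%g.

(** Homotopy invariance, by tiling. On a small rectangle mapped into one [W j] both sides are the
    quotient of [s j] at two opposite corners. Rectangles are then glued side by side into a strip,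
    and strips are stacked. *)
Lemma holonomy_rectangle (H : I * I -> Y) (a b c d : I) :
  continuous H ->
  (holonomy (fun t => H (t, c)) a b * holonomy (fun u => H (b, u)) c d =
   holonomy (fun u => H (a, u)) c d * holonomy (fun t => H (t, d)) a b)%g.
Proof.
move=> cH; rewrite -/(rectangle H a b c d).
have cH1 (u : I) : continuous (fun t => H (t, u)).
  apply: continuous_compT cH.
  by apply: pairT_continuous; [by move=> t|exact: cst_continuous].
have cH2 (t : I) : continuous (fun u => H (t, u)).
  apply: continuous_compT cH.
  by apply: pairT_continuous; [exact: cst_continuous|by move=> u].
have local (c' x : I) : \forall y \near x, \forall d \near c', rectangle H x y c' d.
  have [j Wj] := W_cover (H (x, c')).
  have : nbhs (x, c') (H @^-1` W j) by apply: cH; apply: open_nbhs_nbhs.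
  case=> -[N1 N2] /= [/unit_interval_nbhsP[e1 e10 eN1]].
  move=> /unit_interval_nbhsP[e2 e20 eN2] N12.
  apply: filterS (unit_interval_nbhs_ball x e10) => y xy.
  apply: filterS (unit_interval_nbhs_ball c' e20) => u cu.
  have xx : `|sval x - sval x| < e1 by rewrite subrr normr0.
  have cc : `|sval c' - sval c'| < e2 by rewrite subrr normr0.
  have HW t v : `|sval x - sval t| < e1 -> `|sval c' - sval v| < e2 -> W j (H (t, v)).
    by move=> xt cv; apply: (N12 (t, v)); split; [exact: eN1|exact: eN2].
  rewrite /rectangle !(@holonomy_local _ _ _ j) //;
    try by move=> t; apply: HW => //; exact: segment_within.
  by rewrite -!mulgA !mulVKg.
(* For a fixed bottom [c'] the admissible heights of two adjacent rectangles are intersected, so a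
   thin strip exists over any base from [x] to [y]. *)
have tube (c' x y : I) : \forall d \near c', rectangle H x y c' d.
  move: x y; apply: unit_interval_rel_total (local c') => [x y|x y z].
    apply: filterS => u; rewrite /rectangle.
    rewrite (holonomyV _ x y) (holonomyV _ x y) => e.
    apply: (mulgI (holonomy (fun t => H (t, c')) x y)).
    by rewrite mulVKg mulgA e mulgK.
  apply: filterS2 => u; rewrite /rectangle => e1 e2.
  by rewrite -(holonomyM _ x y z) -mulgA e2 mulgA e1 -mulgA holonomyM.
move: c d; apply: unit_interval_rel_total (fun c => tube c a b) => [c d|c d u].
  rewrite /rectangle (holonomyV (fun u => H (b, u)) c d).
  rewrite (holonomyV (fun u => H (a, u)) c d) => e.
  apply: (mulIg (holonomy (fun u => H (b, u)) c d)).
  by rewrite mulgVK -mulgA e mulKg.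
rewrite /rectangle => e1 e2.
by rewrite -(holonomyM _ c d u) mulgA e1 -mulgA e2 mulgA holonomyM.
Qed.

End holonomy.

(** * Classes of paths *)

Section path_class.
Variables (R : realType) (Y : topologicalType) (y0 : Y).
Notation I := (unit_interval R).
Variable sigma : forall x, {path I from y0 to x}.

(* Closing paths up by the chosen paths sigma gives a class in the group at y0
   to a path with arbitrary ends, multiplicatively. *)
Definition path_class x y (p : {path I from x to y}) : fundamental_group R y0 :=
  loop_class (path_mul (path_mul (sigma x) p) (path_inv (sigma y))).

Lemma path_class_homotopic x y (p q : {path I from x to y}) :
  path_homotopic p q -> path_class p = path_class q.
Proof.
move=> pq; apply/loop_classP; apply: path_mul_homotopic.
  by apply: path_mul_homotopic => //; exact: path_homotopic_refl.
exact: path_homotopic_refl.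
Qed.

Lemma path_class_mul x y z (p : {path I from x to y}) (q : {path I from y to z}) :
  path_class (path_mul p q) = (path_class p * path_class q)%g.
Proof.
rewrite /path_class [RHS]pi1_mulE; apply/loop_classP.
apply: path_homotopic_trans (path_mulA _ _ _).
apply: (path_homotopic_trans (g := path_mul (path_mul (sigma x) p)
  (path_mul q (path_inv (sigma z))))).
  apply: path_homotopic_trans (path_homotopic_sym (path_mulA _ _ _)).
  apply: path_mul_homotopic (path_homotopic_refl _).
  exact: path_mulA.
apply: path_mul_homotopic; first exact: path_homotopic_refl.
apply: path_homotopic_sym.
apply: (path_homotopic_trans (g := path_mul (path_inv (sigma y))
  (path_mul (sigma y) (path_mul q (path_inv (sigma z)))))).
  apply: path_mul_homotopic; first exact: path_homotopic_refl.
  exact/path_homotopic_sym/path_mulA.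
apply: path_homotopic_trans (path_mulA _ _ _) _.
apply: (path_homotopic_trans (g := path_mul (path_cst R y)
  (path_mul q (path_inv (sigma z))))).
  by apply: path_mul_homotopic (path_homotopic_refl _); exact: path_mulVl.
exact: path_mul1l.
Qed.

(** On loops at the base point [path_class] is conjugation by the class of [sigma y0], which may be
    a nontrivial loop. *)
Lemma path_class_inj (p q : {path I from y0 to y0}) :
  path_class p = path_class q -> path_homotopic p q.
Proof.
rewrite /path_class -!pi1_mulE -!/(_ * _)%g => /mulIg /mulgI.
by move/loop_classP.
Qed.

(** The class is freed from the end points in the type of a path, so that functions can be rewritten
    under it; discontinuous functions get the dummy class 1. *)
Definition fun_class (f : I -> Y) : fundamental_group R y0 :=
  if pselect (continuous f) is left cf then path_class (mk_path cf erefl erefl)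
  else 1%g.

Lemma fun_class_path x y (p : {path I from x to y}) : fun_class p = path_class p.
Proof.
rewrite /fun_class; case: pselect => [cp|/(_ (@cts_fun _ _ p))//].
have e (f : I -> Y) (cf : continuous f) (x' y' : Y) (f0 : f zero = x')
    (f1 : f one = y') :
    path_class (mk_path cf erefl erefl) = path_class (mk_path cf f0 f1).
  by subst x' y'.
rewrite (e _ _ _ _ (@path_zero _ _ _ _ p) (@path_one _ _ _ _ p)); congr path_class.
exact/path_eqP.
Qed.

Lemma fun_classM (f g : I -> Y) : continuous f -> continuous g -> f one = g zero ->
  fun_class (path_mul_fun f g) = (fun_class f * fun_class g)%g.
Proof.
move=> cf cg fg.
pose p : {path I from (f zero) to (f one)} := mk_path cf erefl erefl.
pose q : {path I from (f one) to (g one)} := mk_path cg (esym fg) erefl.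
rewrite -[f]/(p : I -> Y) -[g]/(q : I -> Y).
rewrite [fun_class p]fun_class_path [fun_class q]fun_class_path.
by rewrite -path_class_mul -fun_class_path.
Qed.

Lemma segment_continuous2 (T : topologicalType) (a b c : T -> I) :
  continuous a -> continuous b -> continuous c ->
  continuous (fun w => segment (a w) (b w) (c w)).
Proof.
move=> ca cb cc.
have ha : continuous (fun w => sval (a w)).
  exact: continuous_compT (@sval_continuous R).
have hb : continuous (fun w => sval (b w)).
  exact: continuous_compT (@sval_continuous R).
have hc : continuous (fun w => sval (c w)).
  exact: continuous_compT (@sval_continuous R).
apply: continuous_compT (@clampI_continuous R) => w.
apply: cvgD (ha w); apply: cvgM (hc w).
by apply: cvgB; [exact: hb|exact: ha].
Qed.

(** The square is convex: the straight-line homotopy from [a] to [b] fixes the ends and is carried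
    over by [chi]. *)
Lemma fun_class_square (chi : I * I -> Y) (a b : I -> I * I) :
  continuous chi -> continuous a -> continuous b ->
  a zero = b zero -> a one = b one ->
  fun_class (chi \o a) = fun_class (chi \o b).
Proof.
move=> cc ca cb ab0 ab1.
have cca : continuous (chi \o a) by exact: continuous_compT cc.
have ccb : continuous (chi \o b) by exact: continuous_compT cc.
pose p : {path I from (chi (a zero)) to (chi (a one))} := mk_path cca erefl erefl.
have b0 : (chi \o b) zero = chi (a zero) by rewrite /= ab0.
have b1 : (chi \o b) one = chi (a one) by rewrite /= ab1.
pose q : {path I from (chi (a zero)) to (chi (a one))} := mk_path ccb b0 b1.
rewrite -[chi \o a]/(p : I -> Y) -[chi \o b]/(q : I -> Y).
rewrite !fun_class_path; apply: path_class_homotopic.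
have fst' (f : I -> I * I) : continuous f -> continuous (fun w : I * I => f w.1).
  exact: continuous_compT (@fstT_continuous _ _).
exists (fun w => chi (segment (a w.1).1 (b w.1).1 w.2,
                     segment (a w.1).2 (b w.1).2 w.2)).
split=> [|t|t|s|s] /=.
- apply: continuous_compT cc; apply: pairT_continuous; apply: segment_continuous2.
  + by apply: continuous_compT (@fstT_continuous _ _); exact: fst'.
  + by apply: continuous_compT (@fstT_continuous _ _); exact: fst'.
  + exact: sndT_continuous.
  + by apply: continuous_compT (@sndT_continuous _ _); exact: fst'.
  + by apply: continuous_compT (@sndT_continuous _ _); exact: fst'.
  + exact: sndT_continuous.
- by rewrite !segment0 -surjective_pairing.
- by rewrite !segment1 -surjective_pairing.
- by rewrite -!ab0 !segmentxx -surjective_pairing.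
- by rewrite -!ab1 !segmentxx -surjective_pairing.
Qed.

Definition segment_pair (a b : I * I) (t : I) : I * I :=
  (segment a.1 b.1 t, segment a.2 b.2 t).

Lemma segment_pair_continuous (a b : I * I) : continuous (segment_pair a b).
Proof. by apply: pairT_continuous; exact: segment_continuous. Qed.

Definition square_class (chi : I * I -> Y) (a b : I * I) :=
  fun_class (chi \o segment_pair a b).

(** A broken line in the square is homotopic to the straight one with the same ends. The class of a
    segment is thus a cocycle on pairs of points, and all later homotopies inside a polygon reduce
    to algebra with it. *)
Lemma square_classM (chi : I * I -> Y) (a b c : I * I) : continuous chi ->
  (square_class chi a b * square_class chi b c = square_class chi a c)%g.
Proof.
move=> cc; have cs d e := @segment_pair_continuous d e.
have abc : segment_pair a b one = segment_pair b c zero.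
  by rewrite /segment_pair !segment0 !segment1.
pose p : {path I from _ to _} := mk_path (cs a b) erefl erefl.
pose q : {path I from _ to _} := mk_path (cs b c) (esym abc) erefl.
rewrite -fun_classM /=; last 3 first.
- exact: continuous_compT (cs _ _) cc.
- exact: continuous_compT (cs _ _) cc.
- by rewrite abc.
have -> : path_mul_fun (chi \o segment_pair a b) (chi \o segment_pair b c) =
    chi \o path_mul_fun (segment_pair a b) (segment_pair b c).
  by apply/funext => t; rewrite /path_mul_fun /=; case: ifP.
apply: fun_class_square => //.
- exact: (@path_mul_continuous R _ _ _ _ p q).
- by rewrite (@path_mul_zero R _ _ _ _ p q) /segment_pair !segment0.
- by rewrite (@path_mul_one R _ _ _ _ p q) /segment_pair !segment1.
Qed.

Lemma square_classxx (chi : I * I -> Y) (a : I * I) : continuous chi ->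
  square_class chi a a = 1%g.
Proof.
by move=> cc; apply: (mulgI (square_class chi a a)); rewrite square_classM // mulg1.
Qed.

End path_class.

(** * The holonomy of loops as an isomorphism *)

Section trivialized_cover.
Variables (R : realType) (Y : topologicalType) (y0 : Y) (G : groupType).
Notation I := (unit_interval R).
Variable sigma : forall x, {path I from y0 to x}.
Variables (J : Type) (W : J -> set Y) (s : J -> Y -> G).
Hypothesis W_open : forall j, open (W j).
Hypothesis W_cover : forall y, exists j, W j y.
Hypothesis s_locally_constant : forall i j y, W i y -> W j y ->
  \forall z \near y, (s i z * (s j z)^-1 = s i y * (s j y)^-1)%g.
Variable psi : G -> fundamental_group R y0.
Hypothesis psiM : {morph psi : g h / (g * h)%g}.
Variables (u : Y -> fundamental_group R y0) (D : J -> Y -> {compact-open, I -> Y}).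
(* D j y is the way followed by y in a contraction of each component of W j to a
   point; D_class asserts for these ways the formula proved for all paths in
   fun_class_segment. *)
Hypothesis D_open : forall j (O : set {compact-open, I -> Y}), open O ->
  open [set y | W j y /\ O (D j y)].
Hypothesis D_path : forall j y, W j y -> continuous (D j y : I -> Y).
Hypothesis D_start : forall j y, W j y -> D j y zero = y.
Hypothesis D_end : forall j y, W j y -> \forall z \near y, D j z one = D j y one.
Hypothesis D_class : forall j y, W j y -> fun_class sigma (D j y) =
  ((u y)^-1 * psi ((s j y)^-1 * s j (D j y one)) * u (D j y one))%g.

Notation holonomy := (holonomy W s).

Let psiV g : psi g^-1%g = ((psi g)^-1)%g.
Proof.
have psi1 : psi 1%g = 1%g by apply: (mulgI (psi 1%g)); rewrite -psiM !mulg1.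
by apply/esym/mulg1_eq; rewrite -psiM mulgV.
Qed.

Lemma fun_class_cst (c : Y) : fun_class sigma (fun=> c) = 1%g.
Proof.
exact: (square_classxx sigma ((zero : I), (zero : I))
  (@cst_continuous (I * I)%type _ c)).
Qed.

(** The ways [D j (f t)] sweep a square with [f] at the bottom and a constant path at the top. Hence
    [f] is homotopic to the first way followed by the reverse of the last one, and the two instances
    of [D_class] telescope. *)
Lemma fun_class_local (f : I -> Y) (j : J) : continuous f -> (forall t, W j (f t)) ->
  (forall t, D j (f t) one = D j (f zero) one) ->
  fun_class sigma f =
  ((u (f zero))^-1 * psi ((s j (f zero))^-1 * s j (f one)) * u (f one))%g.
Proof.
move=> cf fW fD; pose H (w : I * I) := D j (f w.1) w.2.
(* Openness of the sets in [D_open] makes [D j] continuous along [f] for the compact-open topology;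
   uncurrying over the compact Hausdorff interval then gives joint continuity. *)
have cH : continuous H.
  have -> : H = uncurry (fun t => D j (f t)) by apply/funext => -[].
  apply: continuous_uncurry => [|||t]; last exact: D_path.
  - exact: compact_locally_compact (@unit_interval_compact R).
  - exact: unit_interval_hausdorff.
  - apply/(@continuousP I {compact-open, I -> Y}) => O oO.
    have -> : (fun t => D j (f t)) @^-1` O = f @^-1` [set y | W j y /\ O (D j y)].
      by apply/seteqP; split => t //= [].
    by move/continuousP: cf; apply; exact: D_open.
pose q (a b : I * I) := square_class sigma H a b.
have qM a b c : (q a b * q b c = q a c)%g by exact: square_classM.
have qE a b g : H \o segment_pair a b = g -> q a b = fun_class sigma g.
  by rewrite /q /square_class => ->.
have qf : q (zero, zero) (one, zero) = fun_class sigma f.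
  by apply: qE; apply/funext => t /=; rewrite /H /= segmentxx segment01 D_start.
have qD x : q (x, zero) (x, one) = fun_class sigma (D j (f x)).
  by apply: qE; apply/funext => t /=; rewrite /H /= segmentxx segment01.
have q1 : q (zero, one) (one, one) = 1%g.
  rewrite -(fun_class_cst (D j (f zero) one)); apply: qE; apply/funext => t /=.
  by rewrite /H /= segmentxx segment01 fD.
have : (q (zero, zero) (one, zero) * q (one, zero) (one, one) =
        q (zero, zero) (zero, one) * q (zero, one) (one, one))%g by rewrite !qM.
rewrite qf !qD q1 mulg1 !D_class // fD => /(canRL (mulgK _)) ->.
rewrite !invgM !invgK -psiV invgM invgK !mulgA mulgK.
by rewrite -(mulgA (u (f zero))^-1%g) -psiM mulgA mulgK.
Qed.

Lemma fun_class_segment (f : I -> Y) (x y : I) : continuous f ->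
  fun_class sigma (f \o segment x y) =
  ((u (f x))^-1 * psi (holonomy f x y) * u (f y))%g.
Proof.
move=> cf; pose F (x y : I) := fun_class sigma (f \o segment x y).
have cff : continuous (f \o @fst I I).
  exact: continuous_compT (@fstT_continuous _ _) cf.
have FM a b c : (F a b * F b c = F a c)%g.
  exact: (square_classM sigma (a, zero) (b, zero) (c, zero) cff).
have Fxx a : F a a = 1%g.
  exact: (square_classxx sigma (a, zero) cff).
move: x y; apply: unit_interval_rel_total => [x y|x y z|x]; rewrite -!/(F _ _).
- move=> e; have -> : F y x = ((F x y)^-1)%g.
    by apply/esym/mulg1_eq; rewrite FM.
  by rewrite e !invgM invgK -psiV -holonomyV mulgA.
- move=> e1 e2; rewrite -(FM _ y) e1 e2 -(holonomyM _ _ _ x y z) psiM !mulgA.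
  by rewrite mulgK.
have [j Wj] := W_cover (f x).
(* The ball is chosen so small that the contraction also ends at one and the same point throughout
   it. *)
have /unit_interval_nbhsP[e e0 eN] :
    nbhs x (f @^-1` (W j `&` [set y | D j y one = D j (f x) one])).
  by apply: cf; apply: filterI (D_end Wj); exact: open_nbhs_nbhs.
apply: filterS (unit_interval_nbhs_ball x e0) => y xy.
have seg t : (W j `&` [set y | D j y one = D j (f x) one]) (f (segment x y t)).
  by apply: eN; apply: segment_within => //; rewrite subrr normr0.
have cfs : continuous (f \o segment x y).
  exact: continuous_compT (@segment_continuous R x y) cf.
have segD t : D j ((f \o segment x y) t) one = D j ((f \o segment x y) zero) one.
  by rewrite (seg t).2 /= segment0.
rewrite /F (fun_class_local cfs (fun t => (seg t).1) segD) /= segment0 segment1.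
by rewrite (holonomy_local W_open W_cover s_locally_constant cf (fun t => (seg t).1)).
Qed.

Definition loop_holonomy (a : fundamental_group R y0) : G :=
  holonomy (repr a : {path I from y0 to y0}) zero one.

(** In the rectangle of a homotopy relative to the end points the vertical sides are constant and
    have holonomy 1. *)
Lemma loop_holonomyE (f : {path I from y0 to y0}) :
  loop_holonomy (loop_class f) = holonomy f zero one.
Proof.
have [H [cH H0 H1 Hx Hy]] := repr_loop_class f.
have := holonomy_rectangle W_open W_cover s_locally_constant zero one zero one cH.
have hcst : holonomy (fun=> y0) (zero : I) one = 1%g.
  have [j Wj] := W_cover y0.
  rewrite (holonomy_local W_open W_cover s_locally_constant
    (@cst_continuous I Y y0) (fun=> Wj)).
  exact: mulVg.
have -> : (fun u => H (one, u)) = (fun=> y0) by apply/funext.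
have -> : (fun u => H (zero, u)) = (fun=> y0) by apply/funext.
have -> : (fun u => H (u, zero)) = repr (loop_class f) by apply/funext.
have -> : (fun u => H (u, one)) = f by apply/funext.
by rewrite !hcst mulg1 mul1g.
Qed.

Lemma loop_holonomyM : {morph loop_holonomy : a b / (a * b)%g}.
Proof.
move=> a b; have [f ->] := loop_class_surj a; have [g ->] := loop_class_surj b.
rewrite [(_ * _)%g]pi1_mulE !loop_holonomyE.
set half : I := clampI 2^-1.
have halfE : sval half = 2^-1 by rewrite clampIE //; lra.
rewrite -(holonomyM _ _ _ zero half one).
have fE : f = path_mul f g \o segment zero half :> (I -> Y).
  apply/funext => t; rewrite /= path_mulE segmentE halfE sval0 subr0 addr0.
  have /andP[t0 t1] := unit_intervalP t.
  by rewrite ifT ?mulVKf ?pnatr_eq0 ?clampIK //; lra.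
have gE : g = path_mul f g \o segment half one :> (I -> Y).
  apply/funext => t; rewrite /= path_mulE segmentE halfE sval1.
  have /andP[t0 t1] := unit_intervalP t.
  have -> : 2 * ((1 - 2^-1) * sval t + 2^-1) - 1 = sval t :> R by lra.
  (* The midpoint belongs to the branch of [f]; there [f one] has to be identified with [g zero]. *)
  rewrite clampIK; case: leP => // h.
  have t00 : sval t = 0 by lra.
  rewrite t00 mulr0 add0r mulfV ?pnatr_eq0 // -[t]clampIK t00.
  by rewrite -[clampI 1]/one -[clampI 0]/zero path_zero path_one.
have cfg : continuous (path_mul f g) by exact: cts_fun.
rewrite {1}fE {1}gE !holonomy_comp //; try exact: segment_continuous.
by rewrite !segment0 !segment1.
Qed.

Lemma loop_holonomy_inj : injective loop_holonomy.
Proof.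
move=> a b; have [f ->] := loop_class_surj a; have [g ->] := loop_class_surj b.
rewrite !loop_holonomyE => fg; apply/loop_classP.
apply: (path_class_inj (sigma := sigma)); rewrite -!fun_class_path.
have id01 (h : I -> Y) : h = h \o segment zero one.
  by apply/funext => t /=; rewrite segment01.
rewrite (id01 f) (id01 g) !fun_class_segment; try exact: cts_fun.
by rewrite fg !path_zero !path_one.
Qed.

Theorem loop_holonomy_iso :
  (forall g : G, exists f : {path I from y0 to y0}, holonomy f zero one = g) ->
  exists phi : {multiplicative fundamental_group R y0 -> G}, bijective phi.
Proof.
move=> surj.
pose phi : {multiplicative fundamental_group R y0 -> G} :=
  HB.pack loop_holonomy (isMultiplicative.Build _ _ loop_holonomy loop_holonomyM).
exists phi.
have /choice[psi' psi'K] : forall g, exists a, loop_holonomy a = g.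
  by move=> g; have [f <-] := surj g; exists (loop_class f); exact: loop_holonomyE.
by exists psi' => [a|//]; apply: loop_holonomy_inj; rewrite psi'K.
Qed.

End trivialized_cover.

(** * Polar coordinates *)

Section polar.
Variable R : realType.
Notation I := (unit_interval R).

Fact polar_subproof (n : nat) (i : 'I_n) (w : I * I) :
  (sval w.2 * cos (2 * pi * (i%:R + sval w.1) / n%:R),
   sval w.2 * sin (2 * pi * (i%:R + sval w.1) / n%:R)) \in @disc_set R.
Proof.
apply/mem_set; rewrite /disc_set /= !exprMn -mulrDr cos2Dsin2 mulr1.
by have /andP[? ?] := unit_intervalP w.2; rewrite exprn_ile1.
Qed.

Definition polar (n : nat) (i : 'I_n) (w : I * I) : disc R :=
  exist (fun z : R * R => z \in @disc_set R) _ (polar_subproof i w).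

Lemma polar_boundary (n : nat) (i : 'I_n) (t : I) : polar i (t, one) = disc_boundary i t.
Proof.
apply: val_inj; rewrite -[LHS]/(sval (one : I) * cos _, sval (one : I) * sin _).
by rewrite sval1 !mul1r.
Qed.

Lemma polar_continuous (n : nat) (i : 'I_n) : continuous (polar i).
Proof.
apply: continuous_comp_initial.
have c1 : continuous (fun w : I * I => 2 * pi * (i%:R + sval w.1) / n%:R : R).
  have -> : (fun w : I * I => 2 * pi * (i%:R + sval w.1) / n%:R : R) =
      (fun w => (2 * pi / n%:R) * sval w.1 + 2 * pi * i%:R / n%:R).
    by apply/funext => w; lra.
  apply: affine_continuous.
  exact: continuous_compT (@fstT_continuous _ _) (@sval_continuous R).
have c2 : continuous (fun w : I * I => sval w.2 : R).
  exact: continuous_compT (@sndT_continuous _ _) (@sval_continuous R).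
apply: pairT_continuous => w; apply: (cvgM (c2 w)).
  exact: continuous_compT c1 (@continuous_cos R) w.
exact: continuous_compT c1 (@continuous_sin R) w.
Qed.

Lemma cos_sin_inj (a b : R) : 0 <= a <= 2 * pi -> 0 <= b <= 2 * pi ->
  cos a = cos b -> sin a = sin b -> [\/ a = b, a = b + 2 * pi | b = a + 2 * pi].
Proof.
wlog ab : a b / b <= a => [H|] ha hb ec es.
  have [/H|/ltW /H] := leP b a; first exact.
  by case/(_ hb ha (esym ec) (esym es)) => ->; [exact: Or31|exact: Or33|exact: Or32].
have cd : cos (a - b) = 1 by rewrite cosB ec es -!expr2 cos2Dsin2.
(* Half of the difference lies between 0 and pi, where the sine vanishes only at the two ends. *)
pose d := (a - b) / 2.
have dE : a - b = d *+ 2 by rewrite /d; lra.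
move: cd; rewrite dE cos_mulr2n => cd.
have sd : sin d = 0.
  apply/eqP; rewrite -sqrf_eq0 sin2cos2; apply/eqP; lra.
have [d0|dn0] := eqVneq d 0; first by apply: Or31; move: dE; rewrite d0; lra.
have d0 : 0 < d by rewrite lt_neqAle eq_sym dn0 /d; lra.
have [dpi|pid] := ltP d pi.
  by have := @sin_gt0_pi R d; rewrite d0 dpi sd ltxx => /(_ isT).
apply: Or32; have : d = pi by apply: le_anti; rewrite pid /d andbT; lra.
by move: dE => /[swap] ->; lra.
Qed.

Lemma unit_interval_eq0 (t : I) : sval t = 0 -> t = zero.
Proof. by move=> t0; rewrite -[t]clampIK t0. Qed.

Lemma unit_interval_eq1 (t : I) : sval t = 1 -> t = one.
Proof. by move=> t1; rewrite -[t]clampIK t1. Qed.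

Lemma polar_position_eq (n : nat) (i j : 'I_n) (t u : I) :
  i%:R + sval t = j%:R + sval u ->
  [\/ i = j /\ t = u,
      [/\ t = one, u = zero & j = ordS i] |
      [/\ t = zero, u = one & i = ordS j]].
Proof.
wlog ij : i j t u / (i <= j)%N => [H|] e.
  have [/H|/ltnW /H] := leqP i j; first exact.
  case/(_ _ _ (esym e)) => -[] => [-> ->|? ? ?|? ? ?];
    by [exact: Or31|exact: Or33|exact: Or32].
have /andP[t0 t1] := unit_intervalP t; have /andP[u0 u1] := unit_intervalP u.
move: ij; rewrite leq_eqVlt => /predU1P[/val_inj ij|ij].
  by apply: Or31; split => //; apply: val_inj; move: e; rewrite ij => /addrI.
have ijR : (i.+1%:R : R) <= j%:R by rewrite ler_nat.
rewrite -natr1 in ijR.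
apply: Or32; split; [apply: unit_interval_eq1; lra|apply: unit_interval_eq0; lra|].
apply: val_inj; rewrite /= modn_small; last exact: leq_ltn_trans ij (ltn_ord j).
by apply/eqP; rewrite -(eqr_nat R) -natr1; apply/eqP; lra.
Qed.

Lemma polar_wrap_eq (n : nat) (i j : 'I_n) (t u : I) :
  i%:R + sval t = j%:R + sval u + n%:R ->
  [/\ t = one, u = zero & j = ordS i].
Proof.
move=> e.
have /andP[t0 t1] := unit_intervalP t; have /andP[u0 u1] := unit_intervalP u.
have iR : (i.+1%:R : R) <= n%:R by rewrite ler_nat.
have jR : (0 : R) <= j%:R by exact: ler0n.
rewrite -natr1 in iR.
have j0 : val j = 0%N by apply/eqP; rewrite -(eqr_nat R); apply/eqP => /=; lra.
split; [apply: unit_interval_eq1; lra|apply: unit_interval_eq0; lra|].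
apply: val_inj; rewrite /= j0.
have -> : i.+1 = n by apply/eqP; rewrite -(eqr_nat R) -natr1; apply/eqP; lra.
by rewrite modnn.
Qed.

Lemma polar_angle_range (n : nat) (i : 'I_n) (t : I) :
  0 <= 2 * pi * (i%:R + sval t) / n%:R <= 2 * (pi : R).
Proof.
have /andP[t0 t1] := unit_intervalP t.
have n0 : (0 : R) < n%:R by rewrite ltr0n (leq_ltn_trans (leq0n i)).
have iR : (i.+1%:R : R) <= n%:R by rewrite ler_nat.
rewrite -natr1 in iR.
have p0 : (0 : R) < pi by exact: pi_gt0.
have i0 : (0 : R) <= i%:R by exact: ler0n.
apply/andP; split.
  apply: divr_ge0 (ltW n0); apply: mulr_ge0; last exact: addr_ge0.
  by apply: mulr_ge0 => //; exact: ltW.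
by rewrite ler_pdivrMr // ler_pM2l ?mulr_gt0 //; lra.
Qed.

(** These coincidences are exactly the centre and the radii shared by consecutive sides. A family of
    functions on the squares that respects them therefore descends to the disc. *)
Lemma polar_eq (n : nat) (i j : 'I_n) (w v : I * I) : polar i w = polar j v ->
  w.2 = v.2 /\
  [\/ w.2 = zero, i = j /\ w.1 = v.1,
      [/\ w.1 = one, v.1 = zero & j = ordS i] |
      [/\ w.1 = zero, v.1 = one & i = ordS j]].
Proof.
move=> /(congr1 sval) /= [e1 e2].
have /andP[w0 w1] := unit_intervalP w.2; have /andP[v0 v1] := unit_intervalP v.2.
have wv : sval w.2 = sval v.2.
  apply/eqP; rewrite -(eqrXn2 (n := 2)) //; apply/eqP.
  have sq (r a : R) : r ^+ 2 = (r * cos a) ^+ 2 + (r * sin a) ^+ 2.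
    by rewrite !exprMn -mulrDr cos2Dsin2 mulr1.
  by rewrite (sq (sval w.2) (2 * pi * (i%:R + sval w.1) / n%:R)) e1 e2 -sq.
split; first exact: val_inj.
have [w00|wn0] := eqVneq (sval w.2) 0; first by apply: Or41; exact: unit_interval_eq0.
rewrite -wv in e1 e2.
move/(mulfI wn0) in e1; move/(mulfI wn0) in e2.
have n0 : (0 : R) < n%:R by rewrite ltr0n (leq_ltn_trans (leq0n i)).
have pi0 : (0 : R) < pi by exact: pi_gt0.
have scale a b : 2 * pi * a / n%:R = 2 * pi * b / n%:R -> a = b :> R.
  move/(mulIf (invr_neq0 (lt0r_neq0 n0)))/mulfI; apply.
  by rewrite mulf_neq0 ?pnatr_eq0 // lt0r_neq0.
have wrap : 2 * pi = 2 * pi * n%:R / n%:R :> R by rewrite mulfK // lt0r_neq0.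
case: (cos_sin_inj (polar_angle_range i w.1) (polar_angle_range j v.1) e1 e2).
- by move/scale/polar_position_eq => -[] ?; [exact: Or42|exact: Or43|exact: Or44].
- rewrite {3}wrap -mulrDl -mulrDr => /scale/polar_wrap_eq.
  exact: Or43.
- rewrite {3}wrap -mulrDl -mulrDr => /scale/polar_wrap_eq [? ? ?].
  exact: Or44.
Qed.

Lemma polar_next (n : nat) (i : 'I_n) (r : I) :
  polar i (one, r) = polar (ordS i) (zero, r).
Proof.
apply: val_inj.
rewrite -[LHS]/(sval r * cos (2 * pi * (i%:R + sval (one : I)) / n%:R),
                sval r * sin (2 * pi * (i%:R + sval (one : I)) / n%:R)).
rewrite -[RHS]/(sval r * cos (2 * pi * ((ordS i)%:R + sval (zero : I)) / n%:R),
                sval r * sin (2 * pi * ((ordS i)%:R + sval (zero : I)) / n%:R)).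
rewrite sval0 sval1 addr0 /= natr1.
have := ltn_ord i; rewrite leq_eqVlt => /predU1P[ni|ni]; last by rewrite modn_small.
have n0 : (n%:R : R) != 0 by rewrite pnatr_eq0 -ni.
rewrite ni modnn mulr0 mul0r cos0 sin0 mulfK //.
have -> : 2 * pi = pi *+ 2 :> R by lra.
by rewrite cos2pi sin2pi.
Qed.

Lemma polar_center (n : nat) (i j : 'I_n) (t u : I) :
  polar i (t, zero) = polar j (u, zero).
Proof.
apply: val_inj.
rewrite -[LHS]/(sval (zero : I) * _, sval (zero : I) * _).
rewrite -[RHS]/(sval (zero : I) * _, sval (zero : I) * _).
by rewrite sval0 !mul0r.
Qed.

Lemma polar_surj (n : nat) (z : disc R) : (0 < n)%N ->
  exists (i : 'I_n) w, z = polar i w.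
Proof.
move=> n0; case: z => -[x y] zP.
have xy1 : x ^+ 2 + y ^+ 2 <= 1 by move/set_mem: (zP).
have n0R : (0 : R) < n%:R by rewrite ltr0n.
pose r := Num.sqrt (x ^+ 2 + y ^+ 2).
have rr : r ^+ 2 = x ^+ 2 + y ^+ 2 by rewrite sqr_sqrtr // addr_ge0 ?sqr_ge0.
have r01 : 0 <= r <= 1 by rewrite sqrtr_ge0 -(@expr_le1 _ 2) ?sqrtr_ge0 // rr.
suff [a /andP[a0 a2pi] [xa ya]] :
    exists2 a, 0 <= a < 2 * pi & x = r * cos a /\ y = r * sin a.
  have pi0 : (0 : R) < pi by exact: pi_gt0.
  (* The angle measured in sides: its integer part is the side, its fractional part the parameter on
     it. The strict bound on [a] keeps the integer part below [n]. *)
  pose k := n%:R * a / (2 * pi).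
  have k0 : 0 <= k by apply: divr_ge0; apply: mulr_ge0 => //; exact: ltW.
  have kn : k < n%:R.
    by rewrite ltr_pdivrMr ?(ltr_pM2l n0R) // mulr_gt0.
  have /andP[ik ki] := truncn_itv k0.
  have iP : (Num.truncn k < n)%N by rewrite -(ltr_nat R); exact: le_lt_trans kn.
  exists (Ordinal iP), (clampI (k - (Num.truncn k)%:R), clampI r).
  rewrite -natr1 in ki.
  pose f := sval (clampI (k - (Num.truncn k)%:R)).
  apply: val_inj; rewrite -[RHS]/(
    sval (clampI r) * cos (2 * pi * ((Num.truncn k)%:R + f) / n%:R),
    sval (clampI r) * sin (2 * pi * ((Num.truncn k)%:R + f) / n%:R)).
  rewrite clampIE // /f clampIE; last lra.
  rewrite [_ + (k - _)]addrC subrK.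
  have -> : 2 * pi * k / n%:R = a.
    by rewrite /k mulrC (mulrC (2 * pi)) divfK ?mulKf // lt0r_neq0 // mulr_gt0.
  by rewrite -xa -ya.
have [r0|rn0] := eqVneq r 0.
  exists 0; first by rewrite lexx mulr_gt0 // pi_gt0.
  rewrite r0 !mul0r; move: rr; rewrite r0 expr0n /= => /esym/eqP.
  by rewrite paddr_eq0 ?sqr_ge0 // !sqrf_eq0 => /andP[/eqP -> /eqP ->].
pose c := x / r; pose d := y / r.
have xE : x = r * c by rewrite /c mulrC divfK.
have yE : y = r * d by rewrite /d mulrC divfK.
have cd : c ^+ 2 + d ^+ 2 = 1.
  by rewrite /c /d !expr_div_n -mulrDl -rr divff // expf_neq0.
have d2 : 0 <= d ^+ 2 by exact: sqr_ge0.
have c11 : -1 <= c <= 1.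
  by rewrite -ler_norml -(@expr_le1 _ 2) // real_normK ?num_real //; lra.
have sc : sin (acos c) = `|d|.
  by rewrite sin_acos // -sqrtr_sqr; congr Num.sqrt; lra.
have cc : cos (acos c) = c by rewrite acosK.
have a0 := acos_ge0 c11; have api := acos_lepi c11.
have pi0 : (0 : R) < pi by exact: pi_gt0.
rewrite xE yE; have [d0|d0] := leP 0 d.
  by exists (acos c); [lra|rewrite cc sc ger0_norm].
(* The arc cosine reaches only the upper half circle; below it the angle is 2 pi minus the arc
   cosine, which is less than 2 pi only if the arc cosine is positive. *)
have c1 : c < 1.
  have d20 : 0 < d ^+ 2 by rewrite exprn_even_gt0 //= lt_eqF.
  case/andP: c11 => _; rewrite le_eqVlt => /predU1P[c1|//].
  by move: cd; rewrite c1 expr1n; lra.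
have ap : 0 < acos c by apply: acos_gt0; case/andP: c11 => -> _.
exists (2 * pi - acos c); first lra.
have -> : 2 * pi - acos c = - acos c + pi *+ 2 by lra.
by rewrite cosD2pi sinD2pi cosN sinN cc sc ltr0_norm // opprK.
Qed.


Lemma disc_hausdorff : hausdorff_space (disc R).
Proof.
have cs : continuous (sval : disc R -> R * R).
  exact: (@initial_continuous _ _ (set_val : disc R -> R * R)).
apply: (injective_hausdorff cs); last exact: norm_hausdorff.
by move=> x y e; apply: val_inj.
Qed.

(** The disc carries the quotient topology of its finitely many squares: these are compact and the
    disc is Hausdorff, so closed sets have closed images. *)
Lemma polar_open (n : nat) (A : set (disc R)) : (0 < n)%N ->
  (forall i : 'I_n, open (polar i @^-1` A)) -> open A.
Proof.
move=> n0 oA; rewrite -[A]setCK; apply: closed_openC.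
have -> : ~` A = \bigcup_(i in [set: 'I_n]) (polar i @` (polar i @^-1` (~` A))).
  apply/seteqP; split=> [z nAz|z [i _ [w nAw <-]] //].
  have [i [w zE]] := polar_surj z n0.
  by exists i => //; exists w => //=; rewrite -zE.
apply: closed_bigcup => [|i _]; first exact: finite_finset.
apply: compact_closed; first exact: disc_hausdorff.
apply: continuous_compact; first exact/continuous_subspaceT/polar_continuous.
apply: (@subclosed_compact _ _ [set: I * I]) => //.
  by rewrite preimage_setC; apply: open_closedC; exact: oA.
by rewrite -setXTT; apply: compact_setX; exact: unit_interval_compact.
Qed.

End polar.

(** * The complex of closed walks *)

Definition link_end (K : two_complex) (u : vertex K) (v : vertex (link u)) :
  edge_end K := sval (v : set_type (link_vertex_set u)).

Section cayley_complex.
Variable G : groupType.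

(* A polygon is a closed walk in G, given by its successive vertices; its edges
   are labelled by the quotients of consecutive vertices. *)
Definition walk : choiceType := {n : nat & {ffun 'I_n.+1 -> G}}.

Definition walk_size (p : walk) : nat := (tag p).+1.

Definition walk_step (p : walk) (i : 'I_(walk_size p)) : G :=
  ((tagged p i)^-1 * tagged p (ordS i))%g.

Definition bouquet : multigraph := @Multigraph unit G (fun=> tt).

Definition cayley_complex : two_complex :=
  @TwoComplex bouquet walk walk_size (fun=> isT)
    (fun p i => (walk_step i, false)) (fun _ _ => erefl).

Definition triangle (g h : G) : walk :=
  Tagged (fun n => {ffun 'I_n.+1 -> G})
    [ffun i : 'I_3 => nth 1%g [:: 1; g; g * h]%g i].

Lemma walk_step_triangle (g h : G) :
  [/\ walk_step (p := triangle g h) ord0 = g,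
      walk_step (p := triangle g h) (inord 1) = h &
      walk_step (p := triangle g h) ord_max = ((g * h)^-1)%g].
Proof.
rewrite /walk_step /= !ffunE /= !inordK //=; split.
- by rewrite invg1 mul1g.
- by rewrite mulKg.
- by rewrite mulg1.
Qed.

Lemma cayley_complex_polygon_quotient : polygon_quotient cayley_complex.
Proof.
split=> [[]|g]; first by exists (1%g, false).
by exists (triangle g 1%g), ord0; have [] := walk_step_triangle g 1%g.
Qed.

(** At the corner 1 of [triangle a b] the terminal end of the edge [a] meets the initial end of the
    edge [b], for any [a] and [b]. *)
Lemma cayley_link_adjacent (u : vertex cayley_complex) (v w : vertex (link u)) :
  (link_end v).2 != (link_end w).2 -> Defs.adjacent v w.
Proof.
wlog v2 : v w / (link_end v).2 = true => [H|].
  have /orP[/H|v2] := orbN (link_end v).2; first exact.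
  move=> vw; have w2 : (link_end w).2 = true.
    by move: vw; rewrite (negbTE v2); case: (link_end w).2.
  have [|c [<- <-]] := H w v w2; first by rewrite eq_sym.
  by exists (opposite_end c); split => //; case: c => c [].
move=> w2; have {}w2 : (link_end w).2 = false.
  by move: w2; rewrite v2; case: (link_end w).2.
pose p := triangle (link_end v).1 (link_end w).1.
have [s0 s1 _] := walk_step_triangle (link_end v).1 (link_end w).1.
pose i : 'I_(walk_size p) := inord 1.
pose c : polygon_vertex cayley_complex := Tagged (fun p : walk => 'I_(walk_size p)) i.
have cP : c \in [set c : polygon_vertex cayley_complex | polygon_vertex_image c = u].
  by apply/mem_set => /=; case: (u).
pose e : link_edge u := exist _ c cP.
exists (e, true); split; apply: val_inj.
  rewrite -[RHS]/(link_end v) /= /corner_end /= /opposite_end /=.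
  have -> : ord_pred i = ord0 by apply: val_inj; rewrite /= inordK.
  by rewrite s0; case: (link_end v) v2 => a b /= ->.
rewrite -[RHS]/(link_end w) /= /corner_end /= s1.
by case: (link_end w) w2 => a b /= ->.
Qed.

Lemma cayley_complex_link_connected : link_connected cayley_complex.
Proof.
split; first exact: cayley_complex_polygon_quotient.
move=> u; have ex (b : bool) : exists v : vertex (link u), (link_end v).2 = b.
  pose c : polygon_vertex cayley_complex :=
    Tagged (fun p : walk => 'I_(walk_size p)) (ord0 : 'I_(walk_size (triangle 1 1)%g)).
  have cP : c \in [set c : polygon_vertex cayley_complex | polygon_vertex_image c = u].
    by apply/mem_set => /=; case: u.
  pose e : link_edge u := exist _ c cP.
  by exists (link_endpoint (e, b)); case: b.
split; first by have [v _] := ex true; exists.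
move=> v w; have [e|ne] := eqVneq (link_end v).2 (link_end w).2; last first.
  by apply: rt_step; exact: cayley_link_adjacent.
(* Two ends of the same kind are joined through an end of the other kind. *)
have [x xE] := ex (~~ (link_end v).2).
by apply: (rt_trans _ _ _ x); apply: rt_step; apply: cayley_link_adjacent;
  rewrite xE -?e; case: (link_end v).2.
Qed.

End cayley_complex.

(** * Squares *)

Section square_atlas.
Variables (R : realType) (G : groupType).
Notation I := (unit_interval R).

(* The point (t, r) of the square of the side i of a polygon lies at distance r
   from the centre, in the direction of the point at parameter t of the side. *)
Record square_atlas (Y : topologicalType) (y0 : Y) (edge : G -> I -> Y)
    (chart : forall p : walk G, 'I_(walk_size p) -> I * I -> Y) : Prop :=
  SquareAtlas {
    atlas_edge0 : forall g, edge g zero = y0;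
    atlas_edge1 : forall g, edge g one = y0;
    atlas_edge : forall p (i : 'I_(walk_size p)) t,
      chart p i (t, one) = edge (walk_step i) t;
    atlas_next : forall p (i : 'I_(walk_size p)) r,
      chart p i (one, r) = chart p (ordS i) (zero, r);
    atlas_center : forall p (i : 'I_(walk_size p)) t,
      chart p i (t, zero) = chart p ord0 (zero, zero);
    atlas_continuous : forall p (i : 'I_(walk_size p)), continuous (chart p i);
    atlas_surj : forall y, exists p (i : 'I_(walk_size p)) w, y = chart p i w;
    atlas_open : forall A : set Y,
      (forall p (i : 'I_(walk_size p)), open (chart p i @^-1` A)) -> open A;
    atlas_lift : forall (Z : Type) (z0 : Z) (E : G -> I -> Z) (C : walk G -> Z)
        (F : forall p : walk G, 'I_(walk_size p) -> I * I -> Z),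
      (forall g, E g zero = z0) -> (forall g, E g one = z0) ->
      (forall p (i : 'I_(walk_size p)) t, F p i (t, one) = E (walk_step i) t) ->
      (forall p (i : 'I_(walk_size p)) r, F p i (one, r) = F p (ordS i) (zero, r)) ->
      (forall p (i : 'I_(walk_size p)) t, F p i (t, zero) = C p) ->
      exists f : Y -> Z, forall p (i : 'I_(walk_size p)) w, f (chart p i w) = F p i w }.

Notation K := (cayley_complex G).
Notation X := (realization R K).

Definition cayley_edge (g : G) (t : I) : X := \pi_X (edge_point (K := K) g t).

Definition cayley_chart (p : walk G) (i : 'I_(walk_size p)) (w : I * I) : X :=
  \pi_X (polygon_point (K := K) p (polar i w)).

Lemma glued_eq (a b : cells R K) : glued a b -> \pi_X a = \pi_X b.
Proof. by move=> ab; apply/eqmodP/asboolP; exact: rst_step. Qed.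

Lemma realization_lift (Z : Type) (f : cells R K -> Z) :
  (forall a b, glued a b -> f a = f b) -> forall a, f (repr (\pi_X a)) = f a.
Proof.
move=> fE a.
have gen x y : clos_refl_sym_trans _ (@glued R K) x y -> f x = f y.
  by elim=> {x y} [x y|//|x y _ -> //|x y z _ -> _ -> //]; exact: fE.
have /eqmodP/asboolP : \pi_X (repr (\pi_X a)) = \pi_X a by rewrite reprK.
exact: gen.
Qed.

Lemma cayley_edge0 g : cayley_edge g zero = realization_vertex R (K := K) tt.
Proof. exact: glued_eq (glued_edge R (K := K) (g, false)). Qed.

Lemma reversed_edge_start (g : G) :
  oriented_edge_point (K := K) (g, true) (zero : I) = edge_point (K := K) g one.
Proof.
rewrite -[LHS]/(edge_point (K := K) g (clampI (1 - sval (zero : I)))).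
by rewrite sval0 subr0.
Qed.

Lemma cayley_edge1 g : cayley_edge g one = realization_vertex R (K := K) tt.
Proof.
rewrite /cayley_edge -reversed_edge_start.
exact: glued_eq (glued_edge R (K := K) (g, true)).
Qed.

Lemma cayley_chart_edge p (i : 'I_(walk_size p)) t :
  cayley_chart i (t, one) = cayley_edge (walk_step i) t.
Proof.
rewrite /cayley_chart polar_boundary.
exact: glued_eq (glued_polygon (K := K) i t).
Qed.

Lemma cayley_atlas :
  square_atlas (realization_vertex R (K := K) tt) cayley_edge cayley_chart.
Proof.
split.
- exact: cayley_edge0.
- exact: cayley_edge1.
- exact: cayley_chart_edge.
- by move=> p i r; rewrite /cayley_chart polar_next.
- by move=> p i t; rewrite /cayley_chart (polar_center i ord0 t zero).
- move=> p i; apply: continuous_compT (@pi_continuous _ _).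
  apply: (@continuous_compT _ _ _ (polar i) (@polygon_point R K p)).
    exact: polar_continuous.
  exact: (@existT_continuous _ (closed_cell R (K := K)) (inr p)).
- move=> y; rewrite -[y]reprK; case: (repr y) => -[[[]|g]|p] x.
  + pose p := triangle (1 : G)%g 1%g; exists p, ord0, (zero, one).
    case: x; rewrite -[LHS]/(realization_vertex R (K := K) tt).
    by rewrite cayley_chart_edge cayley_edge0.
  + pose p := triangle g 1%g; exists p, ord0, (x, one).
    by rewrite cayley_chart_edge; have [-> _ _] := walk_step_triangle g 1%g.
  + have [i [w wE]] := polar_surj x (isT : 0 < walk_size p)%N.
    by exists p, i, w; rewrite wE.
- move=> A oA; apply/sigT_openP => -[[[]|g]|p].
  + exact: discrete_open.
  (* The edge [g] is the outer side of the first square of this triangle, so openness on the edge is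
     inherited from that square. *)
  + pose p := triangle g 1%g.
    have -> : existT (closed_cell R (K := K)) (inl (inr g)) @^-1` (\pi_X @^-1` A) =
        (fun t : I => (t, one : I)) @^-1` (cayley_chart (p := p) ord0 @^-1` A).
      apply/funext => t /=; rewrite cayley_chart_edge.
      by have [-> _ _] := walk_step_triangle g 1%g.
    apply: open_comp (oA p ord0) => t _; apply: pairT_continuous.
      by move=> u.
    exact: cst_continuous.
  + by apply: (polar_open (n := walk_size p)) => // i; exact: oA.
move=> Z z0 E C F E0 E1 FE Fnext FC.
(* Polar coordinates are picked arbitrarily; [polar_eq] together with the compatibility of [F] makes
   the value independent of them. *)
pose Fp (p : walk G) (z : disc R) : Z :=
  let iw := projT1 (cid (polar_surj z (isT : 0 < walk_size p)%N)) in
  F p iw (projT1 (cid (projT2 (cid (polar_surj z (isT : 0 < walk_size p)%N))))).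
have FpE p i w : Fp p (polar i w) = F p i w.
  rewrite /Fp; case: cid => j /= e; case: cid => v /= {e}/polar_eq.
  case: w v => t r [u q] /= [<-] [->|[<- <-]//|[-> -> ->]|[-> -> ->]].
  - by rewrite !FC.
  - by rewrite -Fnext.
  - by rewrite -Fnext.
pose f (a : cells R K) : Z := match tag a as c return closed_cell R c -> Z with
  | inl (inl _) => fun=> z0
  | inl (inr g) => fun t => E g t
  | inr p => fun z => Fp p z
  end (tagged a).
exists (fun y : X => f (repr y)) => p i w.
rewrite realization_lift; [exact: FpE|move=> a b [[g []]|q j t]].
- by rewrite reversed_edge_start; exact: E1.
- exact: E0.
- transitivity (Fp q (polar (n := walk_size q) j (t, one))).
    by rewrite polar_boundary.
  by rewrite FpE FE.
Qed.

End square_atlas.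

(** * The fundamental group *)

Section atlas_fundamental_group.
Variables (R : realType) (G : groupType) (Y : topologicalType) (y0 : Y).
Notation I := (unit_interval R).
Variables (edge : G -> I -> Y)
  (chart : forall p : walk G, 'I_(walk_size p) -> I * I -> Y).
Hypothesis atlas : square_atlas y0 edge chart.
Variable sigma : forall x, {path I from y0 to x}.

Implicit Types (p : walk G) (w : I * I).

Definition walk_vertex p (i : 'I_(walk_size p)) : G := tagged p i.

Local Notation q i := (square_class sigma (chart i)).
Local Notation A := ((zero, one) : I * I).
Local Notation B := ((one, one) : I * I).

Lemma chart_continuous p (i : 'I_(walk_size p)) : continuous (chart i).
Proof. exact: (@atlas_continuous _ _ _ _ _ _ atlas). Qed.

Lemma chart_classM p (i : 'I_(walk_size p)) (a b c : I * I) :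
  (q i a b * q i b c = q i a c)%g.
Proof. by apply: square_classM; exact: chart_continuous. Qed.

Lemma chart_classxx p (i : 'I_(walk_size p)) (a : I * I) : q i a a = 1%g.
Proof. by apply: square_classxx; exact: chart_continuous. Qed.

Lemma chart_class_next p (i : 'I_(walk_size p)) (r s : I) :
  q i (one, r) (one, s) = q (ordS i) (zero, r) (zero, s).
Proof.
rewrite /square_class; congr fun_class; apply/funext => t /=.
by rewrite /segment_pair /= !segmentxx (atlas_next atlas).
Qed.

Lemma chart_class_center p (i : 'I_(walk_size p)) (s t : I) :
  q i (s, zero) (t, zero) = 1%g.
Proof.
rewrite -(fun_class_cst sigma (chart (p := p) ord0 (zero, zero))).
rewrite /square_class; congr fun_class; apply/funext => v /=.
by rewrite /segment_pair /= !segmentxx (atlas_center atlas).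
Qed.

(** * Edges, spokes and the relations given by the polygons *)

Definition edge_class (g : G) := fun_class sigma (edge g).

Lemma chart_class_edge p (i : 'I_(walk_size p)) : q i A B = edge_class (walk_step i).
Proof.
rewrite /square_class; congr fun_class; apply/funext => t /=.
by rewrite /segment_pair /= !segmentxx segment01 (atlas_edge atlas).
Qed.

Definition spoke p (i : 'I_(walk_size p)) := q i A (zero, zero).

(** Inside its square a side can be pushed to the two radii that bound the sector: in to the centre
    along one spoke and out along the next. *)
Lemma edge_class_step p (i : 'I_(walk_size p)) :
  edge_class (walk_step i) = (spoke i * (spoke (ordS i))^-1)%g.
Proof.
rewrite -chart_class_edge -(chart_classM _ _ (zero, zero)).
rewrite -(chart_classM _ (zero, zero) (one, zero)) chart_class_center mul1g.
congr (_ * _)%g; apply/esym/mulg1_eq.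
by rewrite /spoke -chart_class_next chart_classM chart_classxx.
Qed.

Lemma edge_class1 : edge_class 1%g = 1%g.
Proof.
(* A monogon: its only spoke is its own successor, so the two spokes cancel. *)
pose p : walk G := Tagged (fun n => {ffun 'I_n.+1 -> G}) [ffun i : 'I_1 => 1%g].
have <- : walk_step (p := p) ord0 = 1%g by rewrite /walk_step /= !ffunE mulVg.
by rewrite edge_class_step [ordS _]ord1 [ord0]ord1 mulgV.
Qed.

(** Around a triangle the spokes telescope to 1. The case of [g] and its inverse yields the
    inverses, and the general case then yields products. *)
Lemma edge_classM : {morph edge_class : g h / (g * h)%g}.
Proof.
have tri g h : (edge_class g * edge_class h * edge_class (g * h)^-1 = 1)%g.
  have [e0 e1 e2] := walk_step_triangle g h.
  move: (edge_class_step (p := triangle g h) ord0).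
  move: (edge_class_step (p := triangle g h) (inord 1)).
  move: (edge_class_step (p := triangle g h) ord_max).
  rewrite e0 e1 e2 => -> -> ->.
  have -> : ordS (ord0 : 'I_(walk_size (triangle g h))) = inord 1.
    by apply: val_inj; rewrite /= inordK.
  have -> : ordS (inord 1 : 'I_(walk_size (triangle g h))) = ord_max.
    by apply: val_inj; rewrite /= inordK.
  have -> : ordS (ord_max : 'I_(walk_size (triangle g h))) = ord0.
    by apply: val_inj.
  by rewrite !mulgA !mulgVK mulgV.
have inv g : edge_class g^-1%g = ((edge_class g)^-1)%g.
  apply/esym/mulg1_eq; have := tri g g^-1%g.
  by rewrite mulgV invg1 edge_class1 mulg1.
by move=> g h; have := tri g h; rewrite inv => /divg1_eq.
Qed.

(** A way to the centre: the loop labelled by a vertex of the walk, then the spoke at that corner.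
    The loop compensates for the choice of the corner ([center_classE]). *)
Definition center_class p :=
  (edge_class (walk_vertex (p := p) ord0) * spoke (p := p) ord0)%g.

Lemma center_classE p (i : 'I_(walk_size p)) :
  center_class p = (edge_class (walk_vertex i) * spoke i)%g.
Proof.
case: i => m; elim: m => [|m IH] im.
  by rewrite /center_class; have -> : Ordinal im = ord0 by apply: val_inj.
have im' : (m < walk_size p)%N by exact: ltnW.
rewrite (IH im').
have <- : ordS (Ordinal im') = Ordinal im by apply: val_inj; rewrite /= modn_small.
have -> : walk_vertex (ordS (Ordinal im')) =
    (walk_vertex (Ordinal im') * walk_step (Ordinal im'))%g.
  by rewrite /walk_step mulVKg.
by rewrite edge_classM edge_class_step !mulgA mulgVK.
Qed.

(** The vertex of the walk at the nearest corner, ties going to the next one. At the centre, common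
    to all sides, a single value is imposed. *)
Definition vertex_label p (i : 'I_(walk_size p)) w : G :=
  if sval w.2 == 0 then 1%g
  else if sval w.1 < 2^-1 then walk_vertex i else walk_vertex (ordS i).

(* The class of the way from the base point to the point w of the square, which
   starts at the nearest corner of the square. *)
Definition nearest_class p (i : 'I_(walk_size p)) w :=
  if sval w.2 == 0 then center_class p
  else if sval w.1 < 2^-1 then q i A w else q i B w.

Lemma vertex_labelE p (i : 'I_(walk_size p)) (t r : I) : vertex_label i (t, r) =
  if sval r == 0 then 1%g
  else if sval t < 2^-1 then walk_vertex i else walk_vertex (ordS i).
Proof. by []. Qed.

Lemma nearest_classE p (i : 'I_(walk_size p)) (t r : I) : nearest_class i (t, r) =
  if sval r == 0 then center_class p
  else if sval t < 2^-1 then q i A (t, r) else q i B (t, r).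
Proof. by []. Qed.

Lemma sval0_lt_half : (sval (zero : I) < 2^-1) = true.
Proof. by rewrite sval0 invr_gt0 ltr0n. Qed.

Lemma sval1_lt_half : (sval (one : I) < 2^-1) = false.
Proof. by rewrite sval1; apply/negbTE; rewrite -leNgt; lra. Qed.

Lemma sval1_eq0 : (sval (one : I) == 0) = false.
Proof. by rewrite sval1 oner_eq0. Qed.

(** The way from the corner [i] and the way from the nearest corner differ by the side between these
    corners, which [vertex_label] records. Every class in a square is thereby expressed through
    labels and [nearest_class]. *)
Lemma chart_class_nearest p (i : 'I_(walk_size p)) w :
  q i A w = (edge_class ((walk_vertex i)^-1 * vertex_label i w) * nearest_class i w)%g.
Proof.
rewrite /vertex_label /nearest_class; case: w => t r /=.
case: ifPn => [/eqP /unit_interval_eq0 ->|_].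
  rewrite -(chart_classM _ _ (zero, zero)) chart_class_center !mulg1.
  rewrite (center_classE i).
  by rewrite mulgA -edge_classM mulVg edge_class1 mul1g.
case: ifPn => _; first by rewrite mulVg edge_class1 mul1g.
by rewrite -chart_class_edge chart_classM.
Qed.

Lemma base_class_exists : exists u : Y -> fundamental_group R y0,
  forall p (i : 'I_(walk_size p)) w, u (chart i w) = nearest_class i w.
Proof.
(* On a side the nearest corner is the nearer end of the edge, so the value depends only on the edge
   and not on the polygon. *)
pose E (g : G) (t : I) :=
  fun_class sigma (edge g \o segment (if sval t < 2^-1 then zero else one) t).
have Ecst (g : G) (x : I) : fun_class sigma (edge g \o segment x x) = 1%g.
  rewrite -(fun_class_cst sigma (edge g x)); congr fun_class; apply/funext => t.
  by rewrite /= segmentxx.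
apply: (atlas_lift atlas (z0 := 1%g) (E := E) (C := center_class)).
- by move=> g; rewrite /E sval0_lt_half.
- by move=> g; rewrite /E sval1_lt_half.
- move=> p i t; rewrite nearest_classE /E sval1_eq0.
  by case: ifPn => _; rewrite /square_class; congr fun_class; apply/funext => v;
    rewrite /= /segment_pair /= segmentxx (atlas_edge atlas).
- by move=> p i r; rewrite !nearest_classE sval0_lt_half sval1_lt_half chart_class_next.
- by move=> p i t; rewrite nearest_classE sval0 eqxx.
Qed.

(** * The stars of the cells, their labels and their contractions *)

Inductive stratum := VertexStar | EdgeStar | FaceStar.

(** Each index stands for the union of all open stars of one kind. The vertex star omits the centres
    and the radii to the midpoints of sides, the edge star the centres and the radii to the corners,
    the face star the boundary. *)
Definition star_domain (j : stratum) w : bool :=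
  match j with
  | VertexStar => (sval w.2 != 0) && (sval w.1 != 2^-1)
  | EdgeStar => (sval w.2 != 0) && ((sval w.1 != 0) && (sval w.1 != 1))
  | FaceStar => sval w.2 != 1
  end.

Lemma star_domainE (j : stratum) (t r : I) : star_domain j (t, r) =
  match j with
  | VertexStar => (sval r != 0) && (sval t != 2^-1)
  | EdgeStar => (sval r != 0) && ((sval t != 0) && (sval t != 1))
  | FaceStar => sval r != 1
  end.
Proof. by []. Qed.

(** [vertex_label] jumps only at centres and across the radii to midpoints, which the vertex star
    avoids; between the edge and face stars the jump cancels and [walk_vertex i] inverted remains.
    Hence quotients of labels are locally constant. *)
Definition star_label (j : stratum) p (i : 'I_(walk_size p)) w : G :=
  match j with
  | VertexStar => 1%g
  | EdgeStar => ((walk_vertex i)^-1 * vertex_label i w)%g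
  | FaceStar => vertex_label i w
  end.

Definition star_target (j : stratum) w : I * I :=
  match j with
  | VertexStar => (if sval w.1 < 2^-1 then zero else one, one)
  | EdgeStar => (clampI 2^-1, one)
  | FaceStar => (w.1, zero)
  end.

(* The membership in a star, the label, and the contracting path, bundled with a
   dummy value outside of the star for a single use of atlas_lift. *)
Definition star_data (j : stratum) p (i : 'I_(walk_size p)) w : bool * G * (I -> Y) :=
  if star_domain j w
  then (true, star_label j i w, chart i \o segment_pair w (star_target j w))
  else (false, 1%g, fun=> y0).

Lemma star_data_exists (j : stratum) : exists f : Y -> bool * G * (I -> Y),
  forall p (i : 'I_(walk_size p)) w, f (chart i w) = star_data j i w.
Proof.
have pathE p (i : 'I_(walk_size p)) t s :
    chart i \o segment_pair (t, one) (s, one) = edge (walk_step i) \o segment t s.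
  by apply/funext => v; rewrite /= /segment_pair /= segmentxx (atlas_edge atlas).
have pathN p (i : 'I_(walk_size p)) r s :
    chart i \o segment_pair (one, r) (one, s) =
    chart (ordS i) \o segment_pair (zero, r) (zero, s).
  by apply/funext => v; rewrite /= /segment_pair /= !segmentxx (atlas_next atlas).
have path0 g : edge g \o segment zero zero = (fun=> y0).
  by apply/funext => v; rewrite /= segmentxx (atlas_edge0 atlas).
have path1 g : edge g \o segment one one = (fun=> y0).
  by apply/funext => v; rewrite /= segmentxx (atlas_edge1 atlas).
have half0 : (sval (zero : I) != 2^-1) = true by rewrite sval0; apply/eqP => ?; lra.
have half1 : (sval (one : I) != 2^-1) = true by rewrite sval1; apply/eqP => ?; lra.
have lE p (i : 'I_(walk_size p)) w : star_label j i w = match j with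
  | VertexStar => 1%g
  | EdgeStar => ((walk_vertex i)^-1 * vertex_label i w)%g
  | FaceStar => vertex_label i w
  end by [].
have tE t r : star_target j (t, r) = match j with
  | VertexStar => (if sval t < 2^-1 then zero else one, one)
  | EdgeStar => (clampI 2^-1, one)
  | FaceStar => (t, zero)
  end by [].
have dE := star_domainE j; case: j dE lE tE => dE lE tE.
- pose E (g : G) (t : I) := if sval t != 2^-1
    then (true, 1%g : G, edge g \o segment t (if sval t < 2^-1 then zero else one))
    else (false, 1%g, fun=> y0).
  apply: (atlas_lift atlas (z0 := (true, 1%g, fun=> y0)) (E := E)
    (C := fun=> (false, 1%g, fun=> y0))) => [g|g|p i t|p i r|p i t].
  + by rewrite /E half0 sval0_lt_half path0.
  + by rewrite /E half1 sval1_lt_half path1.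
  + by rewrite /star_data dE tE lE sval1_eq0 pathE.
  + by rewrite /star_data !dE !tE !lE half0 half1 sval0_lt_half sval1_lt_half pathN.
  + by rewrite /star_data dE sval0 eqxx.
(* On a side with label [g] the edge label is 1 on the first half and [g] on the second, whatever
   the polygon. *)
- pose E (g : G) (t : I) := if (sval t != 0) && (sval t != 1)
    then (true, if sval t < 2^-1 then 1%g else g, edge g \o segment t (clampI 2^-1))
    else (false, 1%g, fun=> y0).
  apply: (atlas_lift atlas (z0 := (false, 1%g, fun=> y0)) (E := E)
    (C := fun=> (false, 1%g, fun=> y0))) => [g|g|p i t|p i r|p i t].
  + by rewrite /E sval0 eqxx.
  + by rewrite /E sval1 eqxx andbF.
  + rewrite /star_data dE tE lE sval1_eq0 pathE /E vertex_labelE sval1_eq0.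
    by case: (sval t < 2^-1); rewrite ?mulVg.
  + by rewrite /star_data !dE sval0 sval1 !eqxx !andbF.
  + by rewrite /star_data dE sval0 eqxx.
(* The whole boundary gets the dummy value; the centre belongs to the star and its contracting path
   is constant. *)
- apply: (atlas_lift atlas (z0 := (false, 1%g, fun=> y0))
    (E := fun _ _ => (false, 1%g, fun=> y0))
    (C := fun p => (true, 1%g, fun=> chart (p := p) ord0 (zero, zero))))
    => [g|g|p i t|p i r|p i t] //.
  + by rewrite /star_data dE sval1 eqxx.
  + by rewrite /star_data !dE !tE !lE !vertex_labelE sval0_lt_half sval1_lt_half pathN.
  + rewrite /star_data dE lE tE sval0 eq_sym oner_eq0 vertex_labelE sval0 eqxx.
    congr pair; apply/funext => v.
    by rewrite /= /segment_pair /= !segmentxx (atlas_center atlas).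
Qed.

(** * Local behaviour of labels and contractions *)

Lemma near_neq (T : topologicalType) (f : T -> R) (c : R) t : continuous f ->
  f t != c -> \forall x \near t, f x != c.
Proof.
move=> cf ftc; apply: (continuous_near (P := fun y => y != c) cf).
apply: open_nbhs_nbhs.
by split; first exact: open_neq.
Qed.

Lemma near_lt (T : topologicalType) (f : T -> R) (c : R) t : continuous f ->
  f t != c -> \forall x \near t, (f x < c) = (f t < c).
Proof.
move=> cf; rewrite neq_lt => /orP[ftc|ftc]; rewrite ?ftc ?(lt_gtF ftc).
  apply: (continuous_near (P := fun y => (y < c) = true) cf).
  by apply: open_nbhs_nbhs; split; first exact: open_lt.
have : \forall x \near t, c < f x.
  apply: (continuous_near (P := fun y => c < y) cf).
  by apply: open_nbhs_nbhs; split; first exact: open_gt.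
by apply: filterS => x /lt_gtF.
Qed.

Lemma sval_fst_continuous : continuous (fun w : I * I => sval w.1 : R).
Proof. exact: continuous_compT (@fstT_continuous _ _) (@sval_continuous R). Qed.

Lemma sval_snd_continuous : continuous (fun w : I * I => sval w.2 : R).
Proof. exact: continuous_compT (@sndT_continuous _ _) (@sval_continuous R). Qed.

Lemma star_domain_near j w : star_domain j w -> \forall w' \near w, star_domain j w'.
Proof.
have n1 c := @near_neq _ _ c w sval_fst_continuous.
have n2 c := @near_neq _ _ c w sval_snd_continuous.
case: j => /= [/andP[h1 h2]|/and3P[h1 h2 h3]|]; last exact: n2.
  by apply: filterS2 (n2 _ h1) (n1 _ h2) => w' -> ->.
by apply: filterS3 (n2 _ h1) (n1 _ h2) (n1 _ h3) => w' -> -> ->.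
Qed.

Lemma vertex_label_near p (i : 'I_(walk_size p)) w :
  star_domain VertexStar w -> \forall w' \near w, vertex_label i w' = vertex_label i w.
Proof.
case/andP=> w2 w1; have n2 := near_neq sval_snd_continuous w2.
apply: filterS2 n2 (near_lt sval_fst_continuous w1) => w' w'2.
by rewrite /vertex_label (negbTE w2) (negbTE w'2) => ->.
Qed.

Lemma star_label_near j k p (i : 'I_(walk_size p)) w :
  star_domain j w -> star_domain k w -> \forall w' \near w,
  (star_label j i w' * (star_label k i w')^-1 =
   star_label j i w * (star_label k i w)^-1)%g.
Proof.
case: j; case: k => /= wj wk; try by near=> w'; rewrite ?mulgV.
- by apply: filterS (vertex_label_near i wj) => w' ->.
- by apply: filterS (vertex_label_near i wj) => w' ->.
- by apply: filterS (vertex_label_near i wk) => w' ->.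
- by near=> w'; rewrite !mulgK.
- by apply: filterS (vertex_label_near i wk) => w' ->.
- by near=> w'; rewrite !invgM !mulVKg.
Unshelve. all: by end_near.
Qed.

(** The target of the vertex star jumps at the middle of a side. Replacing it near [w] by a
    continuous [T] defines the contraction on whole squares, where it can be curried. *)
Lemma star_target_near j w : star_domain j w ->
  exists2 T : I * I -> I * I, continuous T & \forall w' \near w, star_target j w' = T w'.
Proof.
case: j => [/andP[_ w1]|_|_].
- exists (fun=> star_target VertexStar w); first exact: cst_continuous.
  by apply: filterS (near_lt sval_fst_continuous w1) => w' /= ->.
- exists (fun=> (clampI 2^-1, one)); first exact: cst_continuous.
  by near=> w'.
- exists (fun w' => (w'.1, zero)); last by near=> w'.
  by apply: pairT_continuous; [exact: fstT_continuous|exact: cst_continuous].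
Unshelve. all: by end_near.
Qed.

Lemma star_end_near j p (i : 'I_(walk_size p)) w : star_domain j w ->
  \forall w' \near w, chart i (star_target j w') = chart i (star_target j w).
Proof.
case: j => [/andP[_ w1]|_|_].
- by apply: filterS (near_lt sval_fst_continuous w1) => w' /= ->.
- by near=> w'.
- by near=> w'; rewrite /star_target !(atlas_center atlas).
Unshelve. all: by end_near.
Qed.

Lemma star_domain_target j w : star_domain j w -> star_domain j (star_target j w).
Proof.
case: j => _; rewrite /star_target star_domainE ?sval1_eq0.
- by case: ifP => _; rewrite ?sval0 ?sval1; apply/eqP => ?; lra.
- by rewrite clampIE; [apply/and3P; split => //; apply/eqP => ?; lra|lra].
- by rewrite sval0 (eq_sym (0 : R)) oner_eq0.
Qed.

(** This trades the label of the star for [vertex_label], in which the classes of ways are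
    expressed: along the contraction of a star the two differ by a constant left factor. *)
Lemma star_label_target j p (i : 'I_(walk_size p)) w : star_domain j w ->
  ((vertex_label i w)^-1 * vertex_label i (star_target j w) =
   (star_label j i w)^-1 * star_label j i (star_target j w))%g.
Proof.
case: j => [/andP[w2 w1]|_|_] //.
- rewrite mulVg /star_target vertex_labelE sval1_eq0 /vertex_label (negbTE w2).
  by case: ifP => _; rewrite ?sval0_lt_half ?sval1_lt_half mulVg.
- by rewrite invgM invgK -!mulgA mulVKg.
Qed.

Theorem atlas_fundamental_group :
  exists phi : {multiplicative fundamental_group R y0 -> G}, bijective phi.
Proof.
have [u uE] := base_class_exists.
have /choice[star starE] := star_data_exists.
pose W j := [set y | (star j y).1.1].
pose s j y := (star j y).1.2.
pose D j y : {compact-open, I -> Y} := (star j y).2.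
have WE j p (i : 'I_(walk_size p)) w : W j (chart i w) <-> star_domain j w.
  by rewrite /W /= starE /star_data; case: ifP.
have sE j p (i : 'I_(walk_size p)) w : star_domain j w ->
    s j (chart i w) = star_label j i w.
  by move=> wj; rewrite /s starE /star_data wj.
have DE j p (i : 'I_(walk_size p)) w : star_domain j w ->
    D j (chart i w) = chart i \o segment_pair w (star_target j w).
  by move=> wj; rewrite /D starE /star_data wj.
have openP (P : set Y) : (forall p (i : 'I_(walk_size p)) w, P (chart i w) ->
    \forall w' \near w, P (chart i w')) -> open P.
  by move=> nP; apply: (atlas_open atlas) => p i; rewrite openE => w /nP.
have seg0 a b : segment_pair a b zero = a :> I * I.
  by rewrite /segment_pair !segment0 -surjective_pairing.
have seg1 a b : segment_pair a b one = b :> I * I.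
  by rewrite /segment_pair !segment1 -surjective_pairing.
have W_open j : open (W j).
  apply: openP => p i w /WE wj.
  by apply: filterS (star_domain_near wj) => w' w'j; apply/WE.
have W_cover y : exists j, W j y.
  have [p [i [w ->]]] := atlas_surj atlas y.
  suff [j wj] : exists j, star_domain j w by exists j; apply/WE.
  (* Off the boundary the face star applies; on it the vertex star, except at the midpoint of a
     side, which lies in the edge star. *)
  have [r1|r1] := eqVneq (sval w.2) 1; last by exists FaceStar.
  have [t2|t2] := eqVneq (sval w.1) 2^-1; last first.
    by exists VertexStar; rewrite /= r1 oner_eq0.
  exists EdgeStar; rewrite /= r1 oner_eq0 t2 /=.
  by apply/andP; split; apply/eqP => ?; lra.
have s_near j k y : W j y -> W k y ->
    \forall z \near y, (s j z * (s k z)^-1 = s j y * (s k y)^-1)%g.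
  move=> yj yk; set c := (s j y * (s k y)^-1)%g.
  have : open [set z | [/\ W j z, W k z & (s j z * (s k z)^-1 = c)%g]].
    apply: openP => p i w [/WE wj /WE wk]; rewrite !sE // => wc.
    have := star_label_near i wj wk.
    apply: filterS3 (star_domain_near wj) (star_domain_near wk) => w' w'j w'k e.
    by split; [exact/WE|exact/WE|rewrite !sE // e].
  rewrite openE => /(_ y) h; apply: filterS (h _); [by move=> z []|by []].
apply: (@loop_holonomy_iso R Y y0 G sigma stratum W s W_open W_cover s_near
  edge_class edge_classM u D).
- move=> j O oO; apply: openP => p i w [/WE wj]; rewrite DE // => Ow.
  have [T cT wT] := star_target_near wj.
  (* The contraction is jointly continuous in the point and the time, so currying gives continuity
     into the compact-open topology. *)
  pose H (v : (I * I) * I) := chart i (segment_pair v.1 (T v.1) v.2).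
  have cH : continuous H.
    have c1 := @fstT_continuous (I * I)%type I.
    have cT1 : continuous (fun v : (I * I) * I => T v.1) by exact: continuous_compT cT.
    apply: continuous_compT (@chart_continuous p i); apply: pairT_continuous.
      apply: segment_continuous2; last exact: sndT_continuous.
        exact: continuous_compT c1 (@fstT_continuous _ _).
      exact: continuous_compT cT1 (@fstT_continuous _ _).
    apply: segment_continuous2; last exact: sndT_continuous.
      exact: continuous_compT c1 (@sndT_continuous _ _).
    exact: continuous_compT cT1 (@sndT_continuous _ _).
  have [cH' _] := continuous_curry cH.
  have HE w' : star_domain j w' -> star_target j w' = T w' ->
      D j (chart i w') = curry H w'.
    by move=> w'j w'T; rewrite DE // w'T.
  have Ow' : nbhs (curry H w : {compact-open, I -> Y}) O.
    apply: open_nbhs_nbhs; split => //.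
    rewrite -(HE w) //; last exact: nbhs_singleton wT.
    by rewrite DE.
  have := cH' w _ Ow'.
  apply: filterS3 (star_domain_near wj) wT => w' w'j w'T Ow''.
  by split; [exact/WE|rewrite HE].
- move=> j y; have [p [i [w ->]]] := atlas_surj atlas y => /WE wj; rewrite DE //.
  exact: continuous_compT (@segment_pair_continuous R _ _) (@chart_continuous p i).
- move=> j y; have [p [i [w ->]]] := atlas_surj atlas y => /WE wj; rewrite DE //.
  by rewrite /= seg0.
- move=> j y; set c := D j y one => yj.
  have : open [set z | W j z /\ D j z one = c].
    apply: openP => p i w [/WE wj]; rewrite DE //= seg1 => wc.
    apply: filterS2 (star_domain_near wj) (star_end_near i wj) => w' w'j e.
    by split; [exact/WE|rewrite DE //= seg1 e].
  rewrite openE => /(_ y) h; apply: filterS (h _); [by move=> z []|by []].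
- move=> j y; have [p [i [w ->]]] := atlas_surj atlas y => /WE wj.
  have tj := star_domain_target wj.
  rewrite (DE _ _ _ _ wj) /= seg1 !sE // !uE -star_label_target //.
  (* The contracting way is the difference of the two ways from the first corner of the square, so
     both sides can be compared by [chart_class_nearest]. *)
  have -> : fun_class sigma (chart i \o segment_pair w (star_target j w)) =
      ((q i A w)^-1 * q i A (star_target j w))%g.
    by apply/esym/(canLR (mulKg _)); rewrite chart_classM.
  rewrite !chart_class_nearest invgM -!mulgA; congr (_ * _)%g.
  rewrite !mulgA; congr (_ * _)%g.
  apply/(canLR (mulKg _)); rewrite -edge_classM; congr edge_class.
  by rewrite -!mulgA mulVKg.
(* Surjectivity. The edge is cut at 1/4 and 3/4: the outer pieces miss the midpoint and lie in the
   vertex star, with label 1; the middle piece misses the ends and lies in the edge star, whose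
   label passes from 1 to [g]. *)
- have r1 (t : I) : (4^-1 - 0) * sval t + 0 != 2^-1 :> R.
    by have /andP[? ?] := unit_intervalP t; apply/eqP => ?; lra.
  have r2 (t : I) : let x := (3 / 4 - 4^-1) * sval t + 4^-1 : R in (x != 0) && (x != 1).
    by have /andP[? ?] := unit_intervalP t; apply/andP; split; apply/eqP => ?; lra.
  have r3 (t : I) : (1 - 3 / 4) * sval t + 3 / 4 != 2^-1 :> R.
    by have /andP[? ?] := unit_intervalP t; apply/eqP => ?; lra.
  have lt1 : 4^-1 < 2^-1 :> R by lra.
  have lt2 : (3 / 4 < 2^-1 :> R) = false by apply/negbTE; rewrite -leNgt; lra.
  pose a : I := clampI 4^-1; pose b : I := clampI (3 / 4).
  have aE : sval a = 4^-1 by rewrite clampIE //; lra.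
  have bE : sval b = 3 / 4 by rewrite clampIE //; lra.
  move=> g; pose p := triangle g 1%g.
  have [step0 _ _] := walk_step_triangle g 1%g.
  have ce : continuous (edge g).
    have -> : edge g = chart (p := p) ord0 \o (fun t => (t, one)).
      by apply/funext => t; rewrite /= (atlas_edge atlas) step0.
    apply: continuous_compT (@chart_continuous _ _).
    by apply: pairT_continuous; [move=> t|exact: cst_continuous].
  exists (mk_path ce (atlas_edge0 atlas g) (atlas_edge1 atlas g)).
  rewrite -[Path.sort _]/(edge g).
  have edgeE t : edge g t = chart (p := p) ord0 (t, one).
    by rewrite (atlas_edge atlas) step0.
  have W1 t : W VertexStar (edge g (segment zero a t)).
    by rewrite edgeE; apply/WE; rewrite star_domainE sval1_eq0 segmentE aE sval0 r1.
  have W2 t : W EdgeStar (edge g (segment a b t)).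
    by rewrite edgeE; apply/WE; rewrite star_domainE sval1_eq0 segmentE aE bE r2.
  have W3 t : W VertexStar (edge g (segment b one t)).
    by rewrite edgeE; apply/WE; rewrite star_domainE sval1_eq0 segmentE bE sval1 r3.
  rewrite -(holonomyM W s (edge g) zero a one) -(holonomyM W s (edge g) a b one).
  rewrite (holonomy_local W_open W_cover s_near ce W1).
  rewrite (holonomy_local W_open W_cover s_near ce W2).
  rewrite (holonomy_local W_open W_cover s_near ce W3).
  have := (W1 zero, W1 one, W2 zero, W2 one, W3 one).
  rewrite !segment0 !segment1 !edgeE => -[[[[/WE w0 /WE wa] /WE wa'] /WE wb] /WE w1].
  have /WE wb' : W VertexStar (chart (p := p) ord0 (b, one)).
    by have := W3 zero; rewrite segment0 edgeE.
  rewrite !sE // /star_label invg1 !mul1g mulg1 !vertex_labelE sval1_eq0 aE bE lt1 lt2.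
  by rewrite mulVg invg1 mul1g -step0.
Qed.

End atlas_fundamental_group.

(** * The wedge *)

Section wedge_of_cayley_complex.
Variables (R : realType) (G : groupType).
Notation I := (unit_interval R).
Notation K := (cayley_complex G).

Lemma atlas_path (Y : topologicalType) (y0 : Y) (edge : G -> I -> Y)
    (chart : forall p : walk G, 'I_(walk_size p) -> I * I -> Y) :
  square_atlas y0 edge chart -> forall y, inhabited {path I from y0 to y}.
Proof.
move=> atlas y; have [p [i [w ->]]] := atlas_surj atlas y.
have cf : continuous (chart p i \o segment_pair (zero, one) w).
  apply: continuous_compT (@atlas_continuous _ _ _ _ _ _ atlas p i).
  exact: segment_pair_continuous.
have f0 : (chart p i \o segment_pair (zero, one) w) zero = y0.
  by rewrite /= /segment_pair !segment0 (atlas_edge atlas) (atlas_edge0 atlas).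
have f1 : (chart p i \o segment_pair (zero, one) w) one = chart p i w.
  by rewrite /= /segment_pair !segment1 -surjective_pairing.
by exists; exact: mk_path cf f0 f1.
Qed.

Lemma cayley_complex_path_connected : path_connected R (realization R K).
Proof.
move=> x y; have [p] := atlas_path (cayley_atlas R G) x.
have [q] := atlas_path (cayley_atlas R G) y.
by exists; exact: path_mul (path_inv p) q.
Qed.

(** The wedge has this single factor and no circle, the circles for the generators being already
    inside the complex. *)
Definition cayley_factor (_ : unit) : wedge_factor R :=
  ComplexFactor (cayley_complex_link_connected G) cayley_complex_path_connected
    (tt : vertex K).

Notation lift :=
  (@wedge_lift _ _ (@pointed_family_base R unit cayley_factor) (Some tt)).

(** The extra one-point space is glued to the vertex of the complex, so the same squares cover the
    wedge and detect its open sets. *)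
Lemma wedge_atlas : square_atlas (wedge_base cayley_factor)
  (fun g t => lift (cayley_edge g t)) (fun p i w => lift (cayley_chart i w)).
Proof.
have atlas := cayley_atlas R G.
have baseE : lift (realization_vertex R (K := K) tt) = wedge_base cayley_factor.
  exact: (@wedge_liftE _ _ (@pointed_family_base R unit cayley_factor) None tt
    (Some tt) (realization_vertex R (K := K) tt)).
split.
- by move=> g; rewrite cayley_edge0.
- by move=> g; rewrite cayley_edge1.
- by move=> p i t; rewrite cayley_chart_edge.
- by move=> p i r; congr lift; exact: atlas_next atlas _ _ _.
- by move=> p i t; congr lift; exact: atlas_center atlas _ _ _.
- move=> p i; apply: continuous_compT (@wedge_lift_continuous _ _ _ (Some tt)).
  exact: (@atlas_continuous _ _ _ _ _ _ atlas p i).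
- move=> y; suff [x ->] : exists x, y = lift x.
    by have [p [i [w ->]]] := atlas_surj atlas x; exists p, i, w.
  have : [set: wedge_product cayley_factor] y by [].
  rewrite -wedgeTE => -[[[]|] _ [x _ <-]]; first by exists x.
  by exists (realization_vertex R (K := K) tt); rewrite baseE; case: x.
- move=> A oA; apply/wedge_openP => -[[]|]; last exact: discrete_open.
  exact: (atlas_open atlas).
move=> Z z0 E C F E0 E1 FE Fnext FC.
have [f fE] := atlas_lift atlas E0 E1 FE Fnext FC.
(* The extra point must take the value at the vertex for the two functions to agree at the base
   points. *)
pose fs (o : option unit) : pointed_family_space cayley_factor o -> Z :=
  match o return pointed_family_space cayley_factor o -> Z with
  | Some _ => f
  | None => fun=> f (realization_vertex R (K := K) tt)
  end.
exists (wedge_fun fs) => p i w.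
by rewrite wedge_lift_funE ?fE // => -[[]|] [[]|].
Qed.

End wedge_of_cayley_complex.

Theorem theorem3p1 (R : realType) (G : groupType) :
  exists (I : choiceType) (F : I -> wedge_factor R)
         (phi : {multiplicative
            fundamental_group R (wedge_base F) -> G}),
    bijective phi.
Proof.
exists unit, (@cayley_factor R G).
have atlas := wedge_atlas R G.
pose sigma y := projT1 (cid (let: inhabits p := atlas_path atlas y in
  ex_intro (fun=> True) p I)).
exact: atlas_fundamental_group atlas sigma.
Qed.
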